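(* Fix $k\in\mathbb{N}$ and let $\mathfrak{X}_{k+1}$ be the completion of $c_{00}([\mathbb{N}]^{k+1})$ under the norm $\|x\|=\sup(\sum_{i=1}^n\|\mathcal{P}_i(x)\|_1^2)^{1/2}$, the supremum taken over all $n$ and all finite sequences $(\mathcal{P}_i)_{i=1}^n$ of pairwise disjoint Schreier plegmatic families in $[\mathbb{N}]^{k+1}$, where $\|\mathcal{P}(x)\|_1=\sum_{s\in\mathcal{P}}|x(s)|$. Let $(e_s)_{s\in[\mathbb{N}]^{k+1}}$ be the natural Hamel basis. Then: (a) $(e_s)_{s\in[\mathbb{N}]^{k+1}}$ (in any enumeration compatible with unconditionality) is an unconditional basis of $\mathfrak{X}_{k+1}$, and the $(k+1)$-sequence $(e_s)_{s\in[\mathbb{N}]^{k+1}}$ generates a $(k+1)$-spreading model isometric to the usual basis of $\ell^1$; (b) $\mathfrak{X}_{k+1}$ is reflexive; (c) no element of $\mathcal{SM}_k(\mathfrak{X}_{k+1})$ is equivalent to the usual basis of $\ell^1$; (d) for no infinite $M\subseteq\mathbb{N}$ and no $x_0\in\mathfrak{X}_{k+1}$ is $(e_s)_{s\in[M]^{k+1}}$ $(k+1)$-Cesàro summable to $x_0$.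
   Context: $[M]^k$: $k$-subsets of $M\subseteq\mathbb{N}$, identified with increasing tuples; $M(l)$ is the $l$-th element of $M$ and $M|n=\{M(1),\dots,M(n)\}$. A family $\mathcal{P}\subseteq[\mathbb{N}]^{k+1}$ is plegmatic if there are finite sets $F_1<\dots<F_{k+1}$ ($\max F_i<\min F_{i+1}$) of equal cardinality with $\mathcal{P}\subseteq F_1\times\dots\times F_{k+1}$; it is Schreier plegmatic if moreover $|F_1|\le\min F_1$. Plegma family: $(s_j)_{j=1}^l$ in $[M]^k$ with $s_1(i)<\dots<s_l(i)$ ($i\le k$), $s_l(i)<s_1(i+1)$ ($i<k$). A $k$-sequence $(x_s)_{s\in[\mathbb{N}]^k}$ in a Banach space $Y$ generates the Hamel basis $(e_n)$ of a seminormed space $(E,\|\cdot\|_* )$ as a $k$-spreading model via infinite $M$ if for a null sequence $\delta_l>0$: $|\|\sum_{j=1}^m a_jx_{s_j}\|-\|\sum_{j=1}^m a_je_j\|_*|\le\delta_l$ for all $m\le l$, plegma $(s_j)_{j=1}^m$ in $[M]^k$ with $s_1(1)\ge M(l)$, $a_j\in[-1,1]$; $\mathcal{SM}_k(Y)$ is the set of all such sequences. $(x_s)_{s\in[M]^k}$ is $k$-Cesàro summable to $x_0$ if $\binom{n}{k}^{-1}\sum_{s\in[M|n]^k}x_s\to x_0$ in norm. *)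

(* Defs.v *)
From Stdlib Require Import Reals Lra List Arith Bool Classical ClassicalEpsilon.
Import ListNotations.
Open Scope R_scope.

(** Conventions: N = {1,2,3,...}.  A finite subset of N with d elements is
    represented by its increasing enumeration, a list of length d. *)

Definition vec := list nat -> R.
Definition vadd (x y : vec) : vec := fun t => x t + y t.
Definition vscale (c : R) (x : vec) : vec := fun t => c * x t.
Definition vsub (x y : vec) : vec := fun t => x t - y t.

Fixpoint incrb (s : list nat) : bool :=
  match s with
  | [] => true
  | a :: t => match t with [] => true | b :: _ => Nat.ltb a b && incrb t end
  end.

Definition subsetN (d : nat) (s : list nat) : Prop :=
  length s = d /\ incrb s = true /\ Forall (fun a => (1 <= a)%nat) s.

Definition e (s : list nat) : vec :=
  fun t => if list_eq_dec Nat.eq_dec t s then 1 else 0.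

Definition plegmatic_via (d : nat) (P F : list (list nat)) : Prop :=
  (forall s, In s P -> subsetN d s) /\
  length F = d /\
  (forall i, (i < d)%nat -> NoDup (nth i F []) /\
                            length (nth i F []) = length (nth 0 F [])) /\
  (forall i a b, (i + 1 < d)%nat -> In a (nth i F []) -> In b (nth (i + 1) F []) ->
                 (a < b)%nat) /\
  (forall s, In s P -> forall i, (i < d)%nat -> In (nth i s 0%nat) (nth i F [])).

Definition schreier_plegmatic (d : nat) (P : list (list nat)) : Prop :=
  exists F, plegmatic_via d P F /\
            (forall a, In a (nth 0 F []) -> (length (nth 0 F []) <= a)%nat).

Definition fam_l1 (x : vec) (P : list (list nat)) : R :=
  fold_right (fun s acc => Rabs (x s) + acc) 0 P.

Definition admissible (d : nat) (Ps : list (list (list nat))) : Prop :=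
  (forall P, In P Ps -> NoDup P /\ schreier_plegmatic d P) /\
  (forall i j, (i < length Ps)%nat -> (j < length Ps)%nat -> i <> j ->
     forall s, In s (nth i Ps []) -> ~ In s (nth j Ps [])).

Definition Qval (x : vec) (Ps : list (list (list nat))) : R :=
  sqrt (fold_right (fun P acc => (fam_l1 x P) ^ 2 + acc) 0 Ps).

Definition normset (d : nat) (x : vec) : R -> Prop :=
  fun t => exists Ps, admissible d Ps /\ t = Qval x Ps.

(** the norm of X_d (a supremum; meaningful when the set is bounded) *)
Definition Xnorm (d : nat) (x : vec) : R :=
  epsilon (inhabits 0) (fun r => is_lub (normset d x) r).

Definition c00 (d : nat) (y : vec) : Prop :=
  (forall t, ~ subsetN d t -> y t = 0) /\
  exists L, forall t, ~ In t L -> y t = 0.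

(** X_d: completion of c00([N]^d), realised concretely as functions on [N]^d *)
Definition inX (d : nat) (x : vec) : Prop :=
  (forall t, ~ subsetN d t -> x t = 0) /\
  exists y : nat -> vec,
    (forall n, c00 d (y n)) /\
    (forall n, bound (normset d (vsub x (y n)))) /\
    Un_cv (fun n => Xnorm d (vsub x (y n))) 0.

Definition finsum (F : list (list nat)) (a : list nat -> R) : vec :=
  fun t => fold_right (fun s acc => a s * e s t + acc) 0 F.

Definition uconv (d : nat) (a : list nat -> R) (x : vec) : Prop :=
  forall eps, 0 < eps ->
    exists F0, NoDup F0 /\ (forall s, In s F0 -> subsetN d s) /\
      forall F, NoDup F -> (forall s, In s F -> subsetN d s) -> incl F0 F ->
        Xnorm d (vsub x (finsum F a)) < eps.

Definition uncond_basis (d : nat) : Prop :=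
  (forall s, subsetN d s -> inX d (e s)) /\
  (forall x, inX d x -> uconv d x x) /\
  (forall x a, inX d x -> uconv d a x -> forall s, subsetN d s -> a s = x s).

Definition bdd_lin_functional (d : nat) (f : vec -> R) (D : R) : Prop :=
  (forall x y, inX d x -> inX d y -> f (vadd x y) = f x + f y) /\
  (forall c x, inX d x -> f (vscale c x) = c * f x) /\
  (forall x, inX d x -> Rabs (f x) <= D * Xnorm d x).

Definition in_dual (d : nat) (f : vec -> R) : Prop := exists D, bdd_lin_functional d f D.

Definition reflexive (d : nat) : Prop :=
  forall Phi : (vec -> R) -> R,
    (forall f g, in_dual d f -> in_dual d g ->
       Phi (fun x => f x + g x) = Phi f + Phi g) ->
    (forall c f, in_dual d f -> Phi (fun x => c * f x) = c * Phi f) ->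
    (exists Cst, forall f D, bdd_lin_functional d f D -> Rabs (Phi f) <= Cst * D) ->
    exists x, inX d x /\ forall f, in_dual d f -> Phi f = f x.

Fixpoint sumR (m : nat) (f : nat -> R) : R :=
  match m with O => 0 | S m' => sumR m' f + f m end.

Definition trunc (m : nat) (a : nat -> R) : nat -> R :=
  fun j => if (1 <=? j)%nat && (j <=? m)%nat then a j else 0.

(** Infinite M ⊆ N, given by its increasing enumeration: M(l) = Mseq (l-1). *)
Definition infinite_seq (Mseq : nat -> nat) : Prop :=
  (1 <= Mseq 0)%nat /\ forall n, (Mseq n < Mseq (S n))%nat.

Definition plegma (d : nat) (Mseq : nat -> nat) (m : nat) (s : nat -> list nat) : Prop :=
  (forall j, (1 <= j <= m)%nat ->
     subsetN d (s j) /\ forall a, In a (s j) -> exists l, Mseq l = a) /\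
  (forall j i, (1 <= j < m)%nat -> (i < d)%nat ->
     (nth i (s j) 0 < nth i (s (S j)) 0)%nat) /\
  (forall i, (i + 1 < d)%nat -> (nth i (s m) 0 < nth (i + 1) (s 1%nat) 0)%nat).

(** Seminormed space with Hamel basis (e_n)_{n>=1}: a seminorm on finitely
    supported coefficient sequences a (a j = coefficient of e_j, j >= 1). *)
Definition finsupp (a : nat -> R) : Prop :=
  exists m, forall j, (j = 0%nat \/ (m < j)%nat) -> a j = 0.

Definition seminormE (snorm : (nat -> R) -> R) : Prop :=
  (forall a b, finsupp a -> finsupp b -> snorm (fun j => a j + b j) <= snorm a + snorm b) /\
  (forall c a, finsupp a -> snorm (fun j => c * a j) = Rabs c * snorm a).

Definition generates (d : nat) (N : vec -> R) (x : list nat -> vec)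
  (snorm : (nat -> R) -> R) (Mseq : nat -> nat) : Prop :=
  exists delta : nat -> R, (forall l, 0 < delta l) /\ Un_cv delta 0 /\
    forall (l m : nat) (s : nat -> list nat) (a : nat -> R),
      (1 <= m <= l)%nat -> plegma d Mseq m s ->
      (Mseq (l - 1) <= nth 0 (s 1%nat) 0)%nat ->
      (forall j, (1 <= j <= m)%nat -> -1 <= a j <= 1) ->
      Rabs (N (fun t => sumR m (fun j => a j * x (s j) t)) - snorm (trunc m a))
        <= delta l.

Definition ell1 (a : nat -> R) : R :=
  epsilon (inhabits 0)
    (fun r => exists m, (forall j, (m < j)%nat -> a j = 0) /\
                        r = sumR m (fun j => Rabs (a j))).

Definition in_SM (k d : nat) (x : list nat -> vec) (snorm : (nat -> R) -> R) : Prop :=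
  (forall s, subsetN k s -> inX d (x s)) /\
  seminormE snorm /\
  exists Mseq, infinite_seq Mseq /\ generates k (Xnorm d) x snorm Mseq.

Definition equiv_l1 (snorm : (nat -> R) -> R) : Prop :=
  exists c C, 0 < c /\ 0 < C /\
    forall m a, c * sumR m (fun j => Rabs (a j)) <= snorm (trunc m a) <=
                C * sumR m (fun j => Rabs (a j)).

(** Cesàro averages binom(n,d)^{-1} sum_{s in [M|n]^d} e_s *)
Definition in_Mn_b (d : nat) (Mseq : nat -> nat) (n : nat) (t : list nat) : bool :=
  Nat.eqb (length t) d && incrb t &&
  forallb (fun a => existsb (Nat.eqb a) (map Mseq (seq 0 n))) t.

Definition cesaro_avg (d : nat) (Mseq : nat -> nat) (n : nat) : vec :=
  fun t => if in_Mn_b d Mseq n t then / Binomial.C n d else 0.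

Definition cesaro_summable (d : nat) (Mseq : nat -> nat) (x0 : vec) : Prop :=
  Un_cv (fun n => Xnorm d (vsub (cesaro_avg d Mseq n) x0)) 0.

(* Main.v *)
(** For a bounded vector [x], a family [Ps] almost attaining the norm leaves little mass
    elsewhere, because families disjoint from [Ps] can be appended to it: the norm has a
    lower l2-estimate. Hence the functions on [N]^(k+1) with finite norm are exactly the
    elements of the space, and their tails are small in norm.

    The main point is that every bounded [k]-sequence [(x_s)] admits plegma families
    [s_1, ..., s_m] such that the norm of [sum a_i x_(s_i)] is small when [|a_i| <= 1/m],
    provided the [a_i] cancel the coordinatewise limit [v] of [(x_s)] along an iterated
    ultrafilter. By the lower estimate, for each prefix of [s] the coordinates having an
    entry in a later gap [(p, q]] carry little mass once [p] is large. So one can choose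
    values [n_1 < n_2 < ...] and cuts [q_0 < q_1 < ...] such that [x_s], for
    [s = (n_(a_1), ..., n_(a_k))], lives essentially on tuples all of whose entries are
    at most [q_0] or lie in one of the [k] blocks [(q_(a-1), q_a]] with [a] among the
    [a_j]. Such a tuple either is below [q_0], or starts below [q_0], or has two of its
    [k+1] entries in one block. Consequently a single Schreier plegmatic family meets at
    most [q_0 + k] of the corresponding parts of [x_(s_1), ..., x_(s_m)], whence an upper
    l2-estimate of order [m ^ (-1/2)] for the average.

    With alternating signs this excludes l1 spreading models of order [k]. Applied to
    sequences tending to zero coordinatewise, it shows that every functional is small on
    vectors supported far away; together with the first paragraph this gives
    reflexivity. Cesaro averages stay large on a product of [k+1] consecutive blocks of
    [M|n]. *)

From mathcomp Require filter.
From Stdlib Require Import Reals Lra Lia List Arith Bool Classical ClassicalEpsilon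
  FunctionalExtensionality.
Require Import Defs.
Import ListNotations.
Open Scope R_scope.
Set Bullet Behavior "Strict Subproofs".

(** * Ultrafilters *)

Definition ultra {T : Type} (W : (T -> Prop) -> Prop) : Prop :=
  (forall A B : T -> Prop, (forall s, A s -> B s) -> W A -> W B) /\
  (forall A B : T -> Prop, W A -> W B -> W (fun s => A s /\ B s)) /\
  (forall A : T -> Prop, W A \/ W (fun s => ~ A s)) /\
  (forall A : T -> Prop, W A -> exists s, A s).

(** An ultrafilter containing the filter of cofinite sets. *)
Lemma free_ultrafilter_nat :
  exists U : (nat -> Prop) -> Prop, ultra U /\ forall N, U (fun n => (N < n)%nat).
Proof.
  set (F := fun A : nat -> Prop => exists N, forall n, (N < n)%nat -> A n).
  assert (PF : filter.ProperFilter F).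
  { constructor.
    - intros [N HN]. exact (HN (S N) (Nat.lt_succ_diag_r N)).
    - constructor.
      + exists 0%nat. intros n _. exact I.
      + intros P Q [N HN] [N' HN']. exists (Nat.max N N'). intros n Hn. split.
        * apply HN. lia.
        * apply HN'. lia.
      + intros P Q HPQ [N HN]. exists N. intros n Hn. apply HPQ, HN, Hn. }
  destruct (@filter.ultraFilterLemma nat F PF) as [U [HU HFU]].
  pose proof (@filter.ultra_proper _ _ HU) as HP.
  pose proof (@filter.filter_filter _ _ HP) as HF.
  exists U. split; [repeat split|].
  - intros A B HAB HA. exact (@filter.filterS _ U HF A B HAB HA).
  - intros A B HA HB. exact (@filter.filterI _ U HF A B HA HB).
  - intros A. exact (@filter.in_ultra_setVsetC _ U A HU).
  - intros A HA. exact (@filter.filter_ex _ U HP A HA).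
  - intros N. apply HFU. exists N. auto.
Qed.

Lemma ultra_mono {T : Type} (W : (T -> Prop) -> Prop) (A B : T -> Prop) :
  ultra W -> (forall s, A s -> B s) -> W A -> W B.
Proof. intros [H _]. apply H. Qed.

Lemma ultra_and {T : Type} (W : (T -> Prop) -> Prop) (A B : T -> Prop) :
  ultra W -> W A -> W B -> W (fun s => A s /\ B s).
Proof. intros [_ [H _]]. apply H. Qed.

Lemma ultra_em {T : Type} (W : (T -> Prop) -> Prop) (A : T -> Prop) :
  ultra W -> W A \/ W (fun s => ~ A s).
Proof. intros [_ [_ [H _]]]. apply H. Qed.

Lemma ultra_ex {T : Type} (W : (T -> Prop) -> Prop) (A : T -> Prop) :
  ultra W -> W A -> exists s, A s.
Proof. intros [_ [_ [_ H]]]. apply H. Qed.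

Lemma ultra_all {T : Type} (W : (T -> Prop) -> Prop) (A : T -> Prop) :
  ultra W -> (forall s, A s) -> W A.
Proof.
  intros HW HA. destruct (ultra_em W A HW) as [H|H]; [exact H|].
  apply ultra_mono with (3 := H); auto.
Qed.

Lemma ultra_forall_in {T B : Type} (W : (T -> Prop) -> Prop) (l : list B)
    (A : B -> T -> Prop) :
  ultra W -> (forall b, In b l -> W (A b)) -> W (fun s => forall b, In b l -> A b s).
Proof.
  intros HW. induction l as [|b l IH]; intros H.
  - apply ultra_all; simpl; tauto.
  - apply ultra_mono with (fun s => A b s /\ forall b', In b' l -> A b' s); auto.
    + intros s [H1 H2] b' [<-|Hb']; auto.
    + apply ultra_and; auto.
      * apply H; left; auto.
      * apply IH. intros; apply H; right; auto.
Qed.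

(** The limit is the supremum of the levels [r] with [r <= y s] for [W]-many [s]; [- C] is such a
    level and no level exceeds [C]. *)
Lemma ultra_limit {T : Type} (W : (T -> Prop) -> Prop) (y : T -> R) (C : R) :
  ultra W -> (forall s, Rabs (y s) <= C) ->
  exists v, forall eps, 0 < eps -> W (fun s => Rabs (y s - v) <= eps).
Proof.
  intros HW HC.
  destruct (completeness (fun r => W (fun s => r <= y s))) as [v [Hv1 Hv2]].
  - exists C. intros r Hr. destruct (ultra_ex W _ HW Hr) as [s Hs].
    specialize (HC s). pose proof (Rle_abs (y s)). lra.
  - exists (- C). apply ultra_all; auto. intros s. specialize (HC s).
    pose proof (Rle_abs (- y s)) as H. rewrite Rabs_Ropp in H. lra.
  - exists v. intros eps He.
    assert (H1 : W (fun s => v - eps <= y s)).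
    { apply NNPP. intros Hn. apply (Rlt_irrefl v).
      apply Rle_lt_trans with (v - eps); [|lra]. apply Hv2.
      intros r Hr. apply Rnot_lt_le. intros Hlt. apply Hn.
      apply ultra_mono with (3 := Hr); auto. intros; lra. }
    assert (H2 : W (fun s => ~ v + eps <= y s)).
    { destruct (ultra_em W (fun s => v + eps <= y s) HW) as [H|H]; auto.
      apply Hv1 in H. lra. }
    apply ultra_mono with (3 := ultra_and W _ _ HW H1 H2); auto.
    intros s [H3 H4]. apply Rabs_le. lra.
Qed.

(* The iterated power of [U], concentrated on the lists of length [r]. *)
Fixpoint Uq (U : (nat -> Prop) -> Prop) (r : nat) (Q : list nat -> Prop) : Prop :=
  match r with
  | O => Q []
  | S r' => U (fun n => Uq U r' (fun tau => Q (n :: tau)))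
  end.

Lemma ultra_Uq (U : (nat -> Prop) -> Prop) (r : nat) : ultra U -> ultra (Uq U r).
Proof.
  intros HU. induction r as [|r IH]; simpl.
  - repeat split; intros; auto.
    + apply classic.
    + exists []; auto.
  - repeat split.
    + intros A B HAB. apply ultra_mono; auto. intros n. apply ultra_mono; auto.
    + intros A B HA HB. apply ultra_mono with (3 := ultra_and U _ _ HU HA HB); auto.
      intros n [H1 H2]. apply ultra_and; auto.
    + intros A.
      destruct (ultra_em U (fun n => Uq U r (fun tau => A (n :: tau))) HU) as [H|H]; auto.
      right. apply ultra_mono with (3 := H); auto. intros n Hn.
      destruct (ultra_em (Uq U r) (fun tau => A (n :: tau)) IH) as [H'|H']; tauto.
    + intros A HA. destruct (ultra_ex U _ HU HA) as [n Hn].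
      destruct (ultra_ex _ _ IH Hn) as [tau Ht]. exists (n :: tau); auto.
Qed.

(** * Finite sums *)

Definition lsum {T : Type} (l : list T) (f : T -> R) : R :=
  fold_right (fun s acc => f s + acc) 0 l.

Arguments lsum {T} l f : simpl never.

Lemma lsum_cons {T : Type} (a : T) (l : list T) (f : T -> R) :
  lsum (a :: l) f = f a + lsum l f.
Proof. reflexivity. Qed.

Lemma lsum_app {T : Type} (l l' : list T) (f : T -> R) :
  lsum (l ++ l') f = lsum l f + lsum l' f.
Proof. induction l; simpl; [unfold lsum; simpl; lra|]. rewrite !lsum_cons, IHl. lra. Qed.

Lemma lsum_ext {T : Type} (l : list T) (f g : T -> R) :
  (forall t, In t l -> f t = g t) -> lsum l f = lsum l g.
Proof.
  induction l; intros H; [reflexivity|].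
  rewrite !lsum_cons, IHl, H; simpl; auto. intros; apply H; simpl; auto.
Qed.

Lemma lsum_le {T : Type} (l : list T) (f g : T -> R) :
  (forall t, In t l -> f t <= g t) -> lsum l f <= lsum l g.
Proof.
  induction l; intros H; [unfold lsum; simpl; lra|]. rewrite !lsum_cons.
  apply Rplus_le_compat; [apply H; simpl; auto|].
  apply IHl. intros; apply H; simpl; auto.
Qed.

Lemma lsum_nonneg {T : Type} (l : list T) (f : T -> R) :
  (forall t, In t l -> 0 <= f t) -> 0 <= lsum l f.
Proof.
  induction l; intros H; [unfold lsum; simpl; lra|]. rewrite lsum_cons.
  apply Rplus_le_le_0_compat; [apply H; simpl; auto|].
  apply IHl. intros; apply H; simpl; auto.
Qed.

Lemma lsum_plus {T : Type} (l : list T) (f g : T -> R) :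
  lsum l (fun t => f t + g t) = lsum l f + lsum l g.
Proof. induction l; [unfold lsum; simpl; lra|]. rewrite !lsum_cons, IHl. lra. Qed.

Lemma lsum_scal {T : Type} (l : list T) (c : R) (f : T -> R) :
  lsum l (fun t => c * f t) = c * lsum l f.
Proof. induction l; [unfold lsum; simpl; lra|]. rewrite !lsum_cons, IHl. lra. Qed.

Lemma lsum_const {T : Type} (l : list T) (c : R) :
  lsum l (fun _ => c) = INR (length l) * c.
Proof.
  induction l; [unfold lsum; simpl; lra|]. rewrite lsum_cons, IHl.
  change (length (a :: l)) with (S (length l)). rewrite S_INR. lra.
Qed.

Lemma lsum_zero {T : Type} (l : list T) (f : T -> R) :
  (forall t, In t l -> f t = 0) -> lsum l f = 0.
Proof. intros H. rewrite (lsum_ext l f (fun _ => 0)), lsum_const; auto; lra. Qed.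

Lemma lsum_exchange {S T : Type} (l : list S) (l' : list T) (f : S -> T -> R) :
  lsum l (fun s => lsum l' (f s)) = lsum l' (fun t => lsum l (fun s => f s t)).
Proof.
  induction l.
  - symmetry. apply lsum_zero. reflexivity.
  - rewrite lsum_cons, IHl, <- lsum_plus. reflexivity.
Qed.

Lemma lsum_Rabs {T : Type} (l : list T) (f : T -> R) :
  Rabs (lsum l f) <= lsum l (fun t => Rabs (f t)).
Proof.
  induction l; [unfold lsum; simpl; rewrite Rabs_R0; lra|]. rewrite !lsum_cons.
  eapply Rle_trans; [apply Rabs_triang|]. lra.
Qed.

Lemma lsum_term_le {T : Type} (l : list T) (f : T -> R) (t : T) :
  (forall t, In t l -> 0 <= f t) -> In t l -> f t <= lsum l f.
Proof.
  induction l; intros H; [simpl; tauto|]. rewrite lsum_cons. intros [<-|Ht].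
  - assert (0 <= lsum l f) by (apply lsum_nonneg; intros; apply H; simpl; auto). lra.
  - assert (0 <= f a) by (apply H; simpl; auto).
    assert (f t <= lsum l f) by (apply IHl; auto; intros; apply H; simpl; auto). lra.
Qed.

Lemma lsum_filter {T : Type} (A : T -> bool) (l : list T) (f : T -> R) :
  lsum (filter A l) f = lsum l (fun t => if A t then f t else 0).
Proof.
  induction l; [reflexivity|]. simpl. rewrite lsum_cons.
  destruct (A a); rewrite ?lsum_cons, IHl; lra.
Qed.

Lemma lsum_map {S T : Type} (g : S -> T) (l : list S) (f : T -> R) :
  lsum (map g l) f = lsum l (fun s => f (g s)).
Proof. induction l; [reflexivity|]. simpl. rewrite !lsum_cons, IHl. reflexivity. Qed.

Lemma lsum_incl_le {T : Type} (l l' : list T) (f : T -> R) :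
  NoDup l -> (forall t, 0 <= f t) -> (forall t, In t l -> f t <> 0 -> In t l') ->
  lsum l f <= lsum l' f.
Proof.
  intros Hl Hf. revert l'. induction Hl as [|a l Ha Hl IH]; intros l' H.
  - apply lsum_nonneg; auto.
  - rewrite lsum_cons. destruct (Req_dec (f a) 0) as [E|E].
    + rewrite E, Rplus_0_l. apply IH. intros; apply H; simpl; auto.
    + destruct (in_split a l' (H a (or_introl eq_refl) E)) as [l1 [l2 ->]].
      rewrite lsum_app, lsum_cons.
      assert (lsum l f <= lsum (l1 ++ l2) f) as HH.
      { apply IH. intros t Ht Hft. pose proof (H t (or_intror Ht) Hft) as Hin.
        apply in_app_or in Hin. apply in_or_app.
        destruct Hin as [Hin|[<-|Hin]]; auto. contradiction. }
      rewrite lsum_app in HH. lra.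
Qed.

Lemma lsum_sq_le {T : Type} (l : list T) (f : T -> R) :
  (lsum l f) ^ 2 <= INR (length l) * lsum l (fun t => f t ^ 2).
Proof.
  induction l as [|a l IH]; [unfold lsum; simpl; lra|]. rewrite !lsum_cons.
  change (length (a :: l)) with (S (length l)). rewrite S_INR.
  set (n := INR (length l)) in *. set (A := lsum l f) in *.
  set (B := lsum l (fun t => f t ^ 2)) in *.
  assert (H : 0 <= INR (length l)) by apply pos_INR. fold n in H.
  destruct (Req_dec n 0) as [E|E].
  - assert (l = []) as ->.
    { destruct l; auto. unfold n in E. simpl length in E. rewrite S_INR in E.
      pose proof (pos_INR (length l)). lra. }
    unfold A, B, lsum. simpl. rewrite E. lra.
  - assert (Hn : 0 < n) by lra.
    (* After multiplication by [n] this is [(n f(a) - A)^2 >= 0] combined with the induction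
       hypothesis [A^2 <= n B]. Cancelling [n] is the reason for treating the empty list apart. *)
    assert (K : 2 * f a * A <= n * (f a) ^ 2 + B).
    { assert (0 <= (n * f a - A) ^ 2) by apply pow2_ge_0.
      apply Rmult_le_reg_l with n; auto.
      replace (n * (n * f a ^ 2 + B)) with ((n * f a) ^ 2 + n * B) by ring.
      replace (n * (2 * f a * A)) with (2 * (n * f a) * A) by ring.
      nra. }
    nra.
Qed.

Lemma sqrt_minkowski2 (a A b B : R) :
  0 <= a -> 0 <= A -> 0 <= b -> 0 <= B ->
  sqrt ((a + b) ^ 2 + (A + B) ^ 2) <= sqrt (a ^ 2 + A ^ 2) + sqrt (b ^ 2 + B ^ 2).
Proof.
  intros. set (s := sqrt (a ^ 2 + A ^ 2)). set (t := sqrt (b ^ 2 + B ^ 2)).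
  assert (Hs : 0 <= s) by apply sqrt_pos. assert (Ht : 0 <= t) by apply sqrt_pos.
  assert (Es : s ^ 2 = a ^ 2 + A ^ 2) by (apply pow2_sqrt; nra).
  assert (Et : t ^ 2 = b ^ 2 + B ^ 2) by (apply pow2_sqrt; nra).
  rewrite <- (sqrt_pow2 (s + t)) by lra. apply sqrt_le_1_alt.
  (* Planar Cauchy-Schwarz, from [(a B - A b)^2 >= 0]. *)
  assert (a * b + A * B <= s * t).
  {
    rewrite <- (sqrt_pow2 (s * t)) by nra.
    rewrite <- (sqrt_pow2 (a * b + A * B)) by nra. apply sqrt_le_1_alt.
    replace ((s * t) ^ 2) with (s ^ 2 * t ^ 2) by ring. rewrite Es, Et.
    assert (0 <= (a * B - A * b) ^ 2) by apply pow2_ge_0. nra. }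
  nra.
Qed.

Lemma lsum_minkowski {T : Type} (l : list T) (f g : T -> R) :
  (forall t, 0 <= f t) -> (forall t, 0 <= g t) ->
  sqrt (lsum l (fun t => (f t + g t) ^ 2)) <=
  sqrt (lsum l (fun t => f t ^ 2)) + sqrt (lsum l (fun t => g t ^ 2)).
Proof.
  intros Hf Hg. induction l as [|a l IH].
  - unfold lsum. simpl. rewrite sqrt_0. lra.
  - rewrite !lsum_cons.
    assert (P : forall h : T -> R, 0 <= lsum l (fun t => h t ^ 2))
      by (intros; apply lsum_nonneg; intros; apply pow2_ge_0).
    (* Each tail sum is written as the square of its root, so that the tails act as a single second
       coordinate in the planar triangle inequality. *)
    rewrite <- (pow2_sqrt (lsum l (fun t => f t ^ 2))) by apply P.
    rewrite <- (pow2_sqrt (lsum l (fun t => g t ^ 2))) by apply P.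
    eapply Rle_trans; [|apply sqrt_minkowski2; auto using sqrt_pos].
    apply sqrt_le_1_alt. apply Rplus_le_compat_l.
    rewrite <- (pow2_sqrt (lsum l (fun t => (f t + g t) ^ 2))) at 1 by apply P.
    apply pow_incr. split; auto using sqrt_pos.
Qed.

Lemma lsum_cauchy_schwarz {T : Type} (l : list T) (f g : T -> R) :
  lsum l (fun t => f t * g t) <=
  sqrt (lsum l (fun t => f t ^ 2)) * sqrt (lsum l (fun t => g t ^ 2)).
Proof.
  assert (P : forall (l : list T) (h : T -> R), 0 <= lsum l (fun t => h t ^ 2))
    by (intros; apply lsum_nonneg; intros; apply pow2_ge_0).
  rewrite <- sqrt_mult by apply P.
  eapply Rle_trans; [apply Rle_abs|]. rewrite <- sqrt_Rsqr_abs. apply sqrt_le_1_alt.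
  unfold Rsqr. induction l as [|a l IH]; [unfold lsum; simpl; lra|]. rewrite !lsum_cons.
  set (F := lsum l (fun t => f t ^ 2)) in *. set (G := lsum l (fun t => g t ^ 2)) in *.
  set (H := lsum l (fun t => f t * g t)) in *.
  assert (HF : 0 <= F) by apply P. assert (HG : 0 <= G) by apply P.
  (* Squaring reduces this to [4 f^2 g^2 F G <= (f^2 G + F g^2)^2], by the induction hypothesis
     [H^2 <= F G]. *)
  assert (K : 2 * (f a * g a) * H <= f a ^ 2 * G + F * g a ^ 2).
  { eapply Rle_trans; [apply Rle_abs|].
    rewrite <- (Rabs_pos_eq (f a ^ 2 * G + F * g a ^ 2)) by nra.
    apply Rsqr_le_abs_0. unfold Rsqr.
    assert (0 <= (f a ^ 2 * G - F * g a ^ 2) ^ 2) by apply pow2_ge_0.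
    assert ((f a * g a) ^ 2 * (H * H) <= (f a * g a) ^ 2 * (F * G))
      by (apply Rmult_le_compat_l; [apply pow2_ge_0|auto]).
    nra. }
  nra.
Qed.

Lemma sumR_lsum (m : nat) (f : nat -> R) : sumR m f = lsum (seq 1 m) f.
Proof.
  induction m; [reflexivity|]. rewrite seq_S, lsum_app, <- IHm. unfold lsum. simpl. lra.
Qed.

(** * The norm *)

(** A classical test, so that lists of tuples can be filtered by an arbitrary set. *)
Definition pb (A : Prop) : bool := if excluded_middle_informative A then true else false.

Lemma pb_true (A : Prop) : pb A = true <-> A.
Proof. unfold pb. destruct (excluded_middle_informative A); intuition congruence. Qed.

Lemma pb_false (A : Prop) : pb A = false <-> ~ A.
Proof. unfold pb. destruct (excluded_middle_informative A); intuition congruence. Qed.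

(** * Restrictions of vectors and the values of families on them *)

Definition restr (A : list nat -> Prop) (x : vec) : vec :=
  fun t => if pb (A t) then x t else 0.

Lemma restr_in (A : list nat -> Prop) (x : vec) (t : list nat) : A t -> restr A x t = x t.
Proof. intros H. unfold restr. apply pb_true in H. rewrite H. reflexivity. Qed.

Lemma restr_out (A : list nat -> Prop) (x : vec) (t : list nat) : ~ A t -> restr A x t = 0.
Proof. intros H. unfold restr. apply pb_false in H. rewrite H. reflexivity. Qed.

Lemma restr_Rabs_le (A : list nat -> Prop) (x : vec) (t : list nat) :
  Rabs (restr A x t) <= Rabs (x t).
Proof.
  unfold restr. destruct (pb (A t)); [lra|]. rewrite Rabs_R0. apply Rabs_pos.
Qed.

Definition restrict_fams (A : list nat -> Prop) (Ps : list (list (list nat))) :=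
  map (filter (fun t => pb (A t))) Ps.

(** The square of [Qval]. It is additive under concatenation of lists of families, which is the
    source of the lower l2-estimate. *)
Definition Q2 (x : vec) (Ps : list (list (list nat))) : R :=
  lsum Ps (fun P => fam_l1 x P ^ 2).

Lemma Qval_sqrt (x : vec) (Ps : list (list (list nat))) : Qval x Ps = sqrt (Q2 x Ps).
Proof. reflexivity. Qed.

Lemma fam_l1_lsum (x : vec) (P : list (list nat)) :
  fam_l1 x P = lsum P (fun s => Rabs (x s)).
Proof. reflexivity. Qed.

Lemma fam_l1_nonneg (x : vec) (P : list (list nat)) : 0 <= fam_l1 x P.
Proof. rewrite fam_l1_lsum. apply lsum_nonneg. intros; apply Rabs_pos. Qed.

Lemma fam_l1_app (x : vec) (P P' : list (list nat)) :
  fam_l1 x (P ++ P') = fam_l1 x P + fam_l1 x P'.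
Proof. rewrite !fam_l1_lsum. apply lsum_app. Qed.

Lemma fam_l1_le (x y : vec) (P : list (list nat)) :
  (forall t, In t P -> Rabs (x t) <= Rabs (y t)) -> fam_l1 x P <= fam_l1 y P.
Proof. apply lsum_le. Qed.

Lemma fam_l1_restr (A : list nat -> Prop) (x : vec) (P : list (list nat)) :
  fam_l1 (restr A x) P = fam_l1 x (filter (fun t => pb (A t)) P).
Proof.
  rewrite !fam_l1_lsum, lsum_filter. apply lsum_ext. intros t _. unfold restr.
  destruct (pb (A t)); auto. apply Rabs_R0.
Qed.

Lemma Q2_nonneg (x : vec) (Ps : list (list (list nat))) : 0 <= Q2 x Ps.
Proof. apply lsum_nonneg. intros; apply pow2_ge_0. Qed.

Lemma Qval_nonneg (x : vec) (Ps : list (list (list nat))) : 0 <= Qval x Ps.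
Proof. apply sqrt_pos. Qed.

Lemma Qval_sq (x : vec) (Ps : list (list (list nat))) : Qval x Ps ^ 2 = Q2 x Ps.
Proof. rewrite Qval_sqrt. apply pow2_sqrt, Q2_nonneg. Qed.

Lemma Qval_le_iff (x : vec) (Ps : list (list (list nat))) (B : R) :
  0 <= B -> (Qval x Ps <= B <-> Q2 x Ps <= B ^ 2).
Proof.
  intros HB. rewrite <- Qval_sq. split; intros H.
  - apply pow_incr. split; auto. apply Qval_nonneg.
  - rewrite <- (sqrt_pow2 B), <- (sqrt_pow2 (Qval x Ps)) by auto using Qval_nonneg.
    apply sqrt_le_1_alt, H.
Qed.

Lemma Q2_mono (x y : vec) (Ps : list (list (list nat))) :
  (forall P t, In P Ps -> In t P -> Rabs (x t) <= Rabs (y t)) -> Q2 x Ps <= Q2 y Ps.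
Proof.
  intros H. apply lsum_le. intros P HP. apply pow_incr. split.
  - apply fam_l1_nonneg.
  - apply fam_l1_le. eauto.
Qed.

Lemma Qval_mono (x y : vec) (Ps : list (list (list nat))) :
  (forall P t, In P Ps -> In t P -> Rabs (x t) <= Rabs (y t)) -> Qval x Ps <= Qval y Ps.
Proof. intros H. apply sqrt_le_1_alt, Q2_mono, H. Qed.

Lemma Qval_triangle (x y : vec) (Ps : list (list (list nat))) :
  Qval (vadd x y) Ps <= Qval x Ps + Qval y Ps.
Proof.
  eapply Rle_trans;
    [|apply (lsum_minkowski Ps (fam_l1 x) (fam_l1 y)); intros; apply fam_l1_nonneg].
  apply sqrt_le_1_alt. apply lsum_le. intros P _. apply pow_incr. split.
  - apply fam_l1_nonneg.
  - rewrite !fam_l1_lsum, <- lsum_plus. apply lsum_le. intros. apply Rabs_triang.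
Qed.

Lemma fam_l1_scale (c : R) (x : vec) (P : list (list nat)) :
  fam_l1 (vscale c x) P = Rabs c * fam_l1 x P.
Proof.
  rewrite !fam_l1_lsum, <- lsum_scal. apply lsum_ext. intros. apply Rabs_mult.
Qed.

Lemma Qval_scale (c : R) (x : vec) (Ps : list (list (list nat))) :
  Qval (vscale c x) Ps = Rabs c * Qval x Ps.
Proof.
  rewrite <- (sqrt_pow2 (Rabs c)) at 1 by apply Rabs_pos. rewrite !Qval_sqrt.
  rewrite <- sqrt_mult by auto using Q2_nonneg, pow2_ge_0. f_equal. unfold Q2.
  rewrite <- lsum_scal. apply lsum_ext. intros. rewrite fam_l1_scale. ring.
Qed.

Lemma Qval_zero (Ps : list (list (list nat))) : Qval (fun _ => 0) Ps = 0.
Proof.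
  transitivity (sqrt 0); [|apply sqrt_0]. rewrite Qval_sqrt. f_equal. apply lsum_zero. intros P _.
  rewrite fam_l1_lsum, lsum_zero; [ring|]. intros. apply Rabs_R0.
Qed.

(** The triangle inequality for several terms. Only pointwise domination is asked for, so that it
    also covers restrictions to overlapping sets. *)
Lemma Qval_lsum_le {B : Type} (l : list B) (x : vec) (y : B -> vec)
    (Ps : list (list (list nat))) :
  (forall P t, In P Ps -> In t P -> Rabs (x t) <= lsum l (fun b => Rabs (y b t))) ->
  Qval x Ps <= lsum l (fun b => Qval (y b) Ps).
Proof.
  intros H. apply Rle_trans with (Qval (fun t => lsum l (fun b => Rabs (y b t))) Ps).
  - apply Qval_mono. intros P t HP Ht. rewrite (Rabs_pos_eq (lsum _ _)); eauto.
    apply lsum_nonneg. intros; apply Rabs_pos.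
  - clear H. induction l as [|b l IH].
    + right. apply Qval_zero.
    + rewrite lsum_cons.
      eapply Rle_trans; [apply (Qval_triangle (fun t => Rabs (y b t)))|].
      apply Rplus_le_compat; [|exact IH]. apply Qval_mono. intros.
      rewrite Rabs_Rabsolu. lra.
Qed.

Lemma Q2_restrict (A : list nat -> Prop) (x : vec) (Ps : list (list (list nat))) :
  Q2 x (restrict_fams A Ps) = Q2 (restr A x) Ps.
Proof.
  unfold Q2, restrict_fams. rewrite lsum_map. apply lsum_ext. intros.
  rewrite fam_l1_restr. reflexivity.
Qed.

Lemma Q2_app (x : vec) (Ps Ps' : list (list (list nat))) :
  Q2 x (Ps ++ Ps') = Q2 x Ps + Q2 x Ps'.
Proof. apply lsum_app. Qed.

(** * Admissible sequences of families *)

Lemma NoDup_app_iff {T : Type} (l l' : list T) :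
  NoDup (l ++ l') <-> NoDup l /\ NoDup l' /\ forall t, In t l -> ~ In t l'.
Proof.
  induction l as [|a l IH]; simpl.
  - split; [intros H; split; [constructor|auto]|tauto].
  - rewrite !NoDup_cons_iff, IH, in_app_iff. split.
    + intros [H1 [H2 [H3 H4]]]. repeat split; auto.
      intros t [<-|Ht]; auto.
    + intros [[H1 H2] [H3 H4]]. repeat split; auto.
      intros [H|H]; [tauto|]. eapply H4; eauto.
Qed.

(** Gathers the absence of repetitions and the disjointness into one [NoDup], which is easy to
    follow when families are appended. *)
Lemma admissible_iff (d : nat) (Ps : list (list (list nat))) :
  admissible d Ps <->
  (forall P, In P Ps -> schreier_plegmatic d P) /\ NoDup (concat Ps).
Proof.
  unfold admissible. induction Ps as [|P Ps IH]; simpl.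
  - split; intros _; repeat split; try tauto; try constructor; intros; lia.
  - rewrite NoDup_app_iff. split.
    + intros [H1 H2]. destruct IH as [IH _]. destruct IH as [IH1 IH2].
      * split; [auto|]. intros i j Hi Hj Hij s. apply (H2 (S i) (S j)); lia.
      * repeat split; auto.
        -- intros P' [<-|HP']; [apply H1|]; auto.
        -- apply H1; auto.
        -- intros t Ht Ht'. apply in_concat in Ht'. destruct Ht' as [P' [HP' Ht']].
           apply (In_nth _ _ []) in HP'. destruct HP' as [j [Hj <-]].
           apply (H2 0%nat (S j)) with t; auto; lia.
    + intros [H1 [H2 [H3 H4]]]. destruct IH as [_ IH]. destruct IH as [IH1 IH2].
      * split; auto.
      * split.
        -- intros P' [<-|HP']; auto.
        -- assert (HH : forall j t, (j < length Ps)%nat ->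
               In t (nth j Ps []) -> In t (concat Ps)).
           { intros j t Hj Ht. apply in_concat. exists (nth j Ps []).
             split; auto. apply nth_In; auto. }
           intros [|i] [|j] Hi Hj Hij s Hs Hs'; simpl in *.
           ++ lia.
           ++ apply (H4 s); auto. apply HH with j; auto; lia.
           ++ apply (H4 s); auto. apply HH with i; auto; lia.
           ++ apply (IH2 i j) with s; auto; lia.
Qed.

Lemma schreier_plegmatic_incl (d : nat) (P P' : list (list nat)) :
  incl P' P -> schreier_plegmatic d P -> schreier_plegmatic d P'.
Proof.
  intros HI [F [[H1 [H2 [H3 [H4 H5]]]] H6]]. exists F. repeat split; auto.
  - apply H1; auto.
  - apply H1; auto.
  - apply H1; auto.
  - apply H3; auto.
  - apply H3; auto.
Qed.

Lemma admissible_nil (d : nat) : admissible d [].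
Proof. apply admissible_iff. split; [simpl; tauto|constructor]. Qed.

Lemma admissible_single (d : nat) (P : list (list nat)) :
  NoDup P -> schreier_plegmatic d P -> admissible d [P].
Proof.
  intros H1 H2. apply admissible_iff. simpl. rewrite app_nil_r. split; auto.
  intros P' [<-|[]]; auto.
Qed.

Lemma admissible_subsetN (d : nat) (Ps : list (list (list nat))) P t :
  admissible d Ps -> In P Ps -> In t P -> subsetN d t.
Proof.
  intros HA HP Ht. apply admissible_iff in HA. destruct HA as [HA _].
  destruct (HA P HP) as [F [[H _] _]]; auto.
Qed.

(** The new families lie in [A], which the old ones avoid, and a subfamily of a Schreier plegmatic
    family is again Schreier plegmatic. *)
Lemma admissible_app_restrict (d : nat) (A : list nat -> Prop)
    (Ps Ps' : list (list (list nat))) :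
  admissible d Ps -> admissible d Ps' ->
  (forall P t, In P Ps -> In t P -> ~ A t) ->
  admissible d (Ps ++ restrict_fams A Ps').
Proof.
  rewrite !admissible_iff. intros [H1 H2] [H3 H4] HA. split.
  - intros P HP. apply in_app_or in HP. destruct HP as [HP|HP]; auto.
    apply in_map_iff in HP. destruct HP as [P' [<- HP']].
    apply schreier_plegmatic_incl with P'; auto. apply incl_filter.
  - unfold restrict_fams. rewrite concat_app, concat_filter_map. apply NoDup_app_iff.
    split; [exact H2|]. split; [apply NoDup_filter, H4|].
    intros t Ht Ht'. apply filter_In in Ht'. destruct Ht' as [_ Ht'].
    apply (proj1 (pb_true _)) in Ht'. apply in_concat in Ht. destruct Ht as [P [HP Ht]].
    exact (HA P t HP Ht Ht').
Qed.

(** A bound for the norm that makes sense before the supremum is known to exist; [Xnorm] has an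
    arbitrary value on unbounded vectors. *)
Definition nle (d : nat) (x : vec) (B : R) : Prop :=
  forall Ps, admissible d Ps -> Qval x Ps <= B.

Lemma nle_nonneg (d : nat) (x : vec) (B : R) : nle d x B -> 0 <= B.
Proof.
  intros H. eapply Rle_trans; [|apply (H [] (admissible_nil d))]. apply Qval_nonneg.
Qed.

Lemma nle_Q2 (d : nat) (x : vec) (B : R) Ps :
  nle d x B -> admissible d Ps -> Q2 x Ps <= B ^ 2.
Proof. intros H HP. apply Qval_le_iff; auto. eapply nle_nonneg; eauto. Qed.

Lemma nle_add (d : nat) (x y : vec) (A B : R) :
  nle d x A -> nle d y B -> nle d (vadd x y) (A + B).
Proof.
  intros H1 H2 Ps HP. eapply Rle_trans; [apply Qval_triangle|].
  apply Rplus_le_compat; auto.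
Qed.

Lemma nle_scale (d : nat) (c : R) (x : vec) (B : R) :
  nle d x B -> nle d (vscale c x) (Rabs c * B).
Proof.
  intros H Ps HP. rewrite Qval_scale. apply Rmult_le_compat_l; auto using Rabs_pos.
Qed.

Lemma nle_mono (d : nat) (x y : vec) (B : R) :
  (forall t, subsetN d t -> Rabs (x t) <= Rabs (y t)) -> nle d y B -> nle d x B.
Proof.
  intros H HB Ps HP. eapply Rle_trans; [|apply HB; eauto]. apply Qval_mono.
  intros P t HP' Ht. apply H. eapply admissible_subsetN; eauto.
Qed.

Lemma nle_weaken (d : nat) (x : vec) (A B : R) : A <= B -> nle d x A -> nle d x B.
Proof. intros H HA Ps HP. eapply Rle_trans; [apply HA|]; auto. Qed.

Lemma bound_nle (d : nat) (x : vec) : bound (normset d x) <-> exists B, nle d x B.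
Proof.
  split.
  - intros [B HB]. exists B. intros Ps HP. apply HB. exists Ps. auto.
  - intros [B HB]. exists B. intros t [Ps [HP ->]]. auto.
Qed.

Lemma Xnorm_lub (d : nat) (x : vec) :
  (exists B, nle d x B) -> is_lub (normset d x) (Xnorm d x).
Proof.
  intros HB. apply bound_nle in HB. unfold Xnorm. apply epsilon_spec.
  destruct (completeness (normset d x)) as [l Hl]; auto.
  - exists (Qval x []), []. split; auto. apply admissible_nil.
  - exists l. auto.
Qed.

Lemma nle_Xnorm (d : nat) (x : vec) : (exists B, nle d x B) -> nle d x (Xnorm d x).
Proof.
  intros H Ps HP. apply Xnorm_lub in H. apply H. exists Ps. auto.
Qed.

Lemma Xnorm_le (d : nat) (x : vec) (B : R) : nle d x B -> Xnorm d x <= B.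
Proof.
  intros H. assert (HL : is_lub (normset d x) (Xnorm d x)) by (apply Xnorm_lub; eauto).
  apply HL. intros t [Ps [HP ->]]. auto.
Qed.

Lemma Xnorm_nonneg (d : nat) (x : vec) : (exists B, nle d x B) -> 0 <= Xnorm d x.
Proof. intros H. eapply nle_nonneg. apply nle_Xnorm, H. Qed.

(** The l2-norm of the masses of the families is at most their sum, and by disjointness this sum
    counts each tuple at most once. *)
Lemma Qval_le_fam_l1 (d : nat) (x : vec) (L : list (list nat)) Ps :
  admissible d Ps ->
  (forall P t, In P Ps -> In t P -> x t <> 0 -> In t L) -> Qval x Ps <= fam_l1 x L.
Proof.
  intros HA HL. apply Rle_trans with (fam_l1 x (concat Ps)).
  - apply Qval_le_iff; [apply fam_l1_nonneg|]. clear HA HL.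
    induction Ps as [|P Ps IH].
    + unfold Q2, fam_l1, lsum. simpl. lra.
    + unfold Q2. rewrite lsum_cons. simpl concat. rewrite fam_l1_app. unfold Q2 in IH.
      pose proof (fam_l1_nonneg x P). pose proof (fam_l1_nonneg x (concat Ps)). nra.
  - apply lsum_incl_le.
    + apply admissible_iff in HA. tauto.
    + intros; apply Rabs_pos.
    + intros t Ht Hx. apply in_concat in Ht. destruct Ht as [P [HP Ht]].
      apply HL with P; auto. intros E. apply Hx. rewrite E. apply Rabs_R0.
Qed.

Lemma nle_finite (d : nat) (x : vec) (L : list (list nat)) :
  (forall t, subsetN d t -> ~ In t L -> x t = 0) -> nle d x (fam_l1 x L).
Proof.
  intros H Ps HP. apply Qval_le_fam_l1 with d; auto. intros P t HP' Ht Hx.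
  apply NNPP. intros Hn. apply Hx, H; auto. eapply admissible_subsetN; eauto.
Qed.

Lemma incrb_nth_S (s : list nat) (i : nat) :
  incrb s = true -> (i + 1 < length s)%nat -> (nth i s 0 < nth (i + 1) s 0)%nat.
Proof.
  revert i. induction s as [|a [|b s] IH]; intros i; simpl length; try lia.
  cbn [incrb]. rewrite andb_true_iff, Nat.ltb_lt. intros [H1 H2] Hi.
  destruct i as [|i]; [exact H1|]. apply (IH i H2). simpl length. lia.
Qed.

(** The sets [F_i] are the singletons of the entries of [s]. *)
Lemma schreier_plegmatic_single (d : nat) (s : list nat) :
  subsetN d s -> schreier_plegmatic d [s].
Proof.
  intros Hs. pose proof Hs as [H1 [H2 H3]].
  assert (Hn : forall i, (i < d)%nat -> nth i (map (fun a => [a]) s) [] = [nth i s 0%nat]).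
  { intros i Hi. rewrite (nth_indep _ _ [0%nat]) by (rewrite length_map; lia).
    apply (map_nth (fun a => [a])). }
  exists (map (fun a => [a]) s). repeat split.
  - destruct H as [<-|[]]; auto.
  - destruct H as [<-|[]]; auto.
  - destruct H as [<-|[]]; auto.
  - rewrite length_map; auto.
  - rewrite Hn by auto. repeat constructor. simpl; tauto.
  - rewrite !Hn by lia. reflexivity.
  - intros i a b Hi. rewrite !Hn by lia. intros [<-|[]] [<-|[]].
    apply incrb_nth_S; auto; lia.
  - intros t [<-|[]] i Hi. rewrite Hn by auto. left; auto.
  (* For [d = 0] the first set is the default empty list; otherwise it has one element, and entries
     are at least 1. *)
  - intros a. destruct d as [|d].
    + destruct s; simpl in *; try lia; tauto.
    + rewrite Hn by lia. intros [<-|[]]. simpl length.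
      rewrite Forall_forall in H3. apply H3. apply nth_In. lia.
Qed.

Lemma nle_coord (d : nat) (x : vec) (B : R) (s : list nat) :
  nle d x B -> subsetN d s -> Rabs (x s) <= B.
Proof.
  intros HB Hs. eapply Rle_trans; [|apply (HB [[s]])].
  - rewrite Qval_sqrt. unfold Q2, fam_l1, lsum. simpl.
    rewrite Rmult_1_r, !Rplus_0_r. rewrite sqrt_square; [lra|apply Rabs_pos].
  - apply admissible_single; [repeat constructor; simpl; tauto|].
    apply schreier_plegmatic_single; auto.
Qed.

(* Lower l2-estimate: families avoiding an almost norming one carry little mass. *)
Lemma small_tail (d : nat) (x : vec) (eps : R) :
  (exists B, nle d x B) -> 0 < eps ->
  exists L, forall A : list nat -> Prop, (forall t, A t -> ~ In t L) -> nle d (restr A x) eps.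
Proof.
  intros HB He. pose proof (nle_Xnorm d x HB) as HN. pose proof (Xnorm_lub d x HB) as HL.
  set (N := Xnorm d x) in *.
  assert (N0 : 0 <= N) by (eapply nle_nonneg; eauto).
  (* If all values stayed below [N^2 - eps^2], the root of this number would be an upper bound
     smaller than the supremum [N]. *)
  assert (HE : exists Ps, admissible d Ps /\ N ^ 2 - eps ^ 2 <= Q2 x Ps).
  { apply NNPP. intros Hn.
    assert (HU : forall Ps, admissible d Ps -> Q2 x Ps < N ^ 2 - eps ^ 2).
    { intros Ps HP. apply Rnot_le_lt. intros H. apply Hn. eauto. }
    assert (H0 : 0 < N ^ 2 - eps ^ 2).
    { eapply Rle_lt_trans; [|apply (HU [])]; auto using Q2_nonneg, admissible_nil. }
    assert (HN' : N <= sqrt (N ^ 2 - eps ^ 2)).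
    { apply HL. intros t [Ps [HP ->]]. apply sqrt_le_1_alt. apply Rlt_le, HU, HP. }
    assert (N ^ 2 <= N ^ 2 - eps ^ 2).
    { rewrite <- (pow2_sqrt (N ^ 2 - eps ^ 2)) by lra. apply pow_incr. lra. }
    nra. }
  destruct HE as [Ps [HP HQ]]. exists (concat Ps). intros A HA Ps' HP'.
  apply Qval_le_iff; [lra|]. rewrite <- Q2_restrict.
  assert (admissible d (Ps ++ restrict_fams A Ps')) as HH.
  { apply admissible_app_restrict; auto. intros P t HPP Ht Hat.
    apply (HA t Hat). apply in_concat; eauto. }
  (* The sum of both contributions is at most [N^2], and [Ps] alone accounts for at least
     [N^2 - eps^2]. *)
  pose proof (nle_Q2 _ _ _ _ HN HH) as HQ'. rewrite Q2_app in HQ'. lra.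
Qed.

(** A limit of finitely supported vectors is at bounded distance from one of them. Conversely a
    bounded vector is approximated within [1/(n+1)] by its restriction to the finite list that
    [small_tail] provides. *)
Lemma inX_iff (d : nat) (x : vec) :
  inX d x <-> (forall t, ~ subsetN d t -> x t = 0) /\ exists B, nle d x B.
Proof.
  split.
  - intros [H0 [y [H1 [H2 _]]]]. split; auto. destruct (H1 0%nat) as [_ [L HL]].
    specialize (H2 0%nat). apply bound_nle in H2. destruct H2 as [B HB].
    exists (B + fam_l1 (y 0%nat) L).
    apply nle_mono with (vadd (vsub x (y 0%nat)) (y 0%nat)).
    + intros t _. unfold vadd, vsub. right. f_equal. ring.
    + apply nle_add; auto. apply nle_finite. auto.
  - intros [H0 HB]. split; auto.
    assert (HC : forall n : nat, exists L, forall A : list nat -> Prop,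
      (forall t, A t -> ~ In t L) -> nle d (restr A x) (/ INR (S n))).
    { intros n. apply small_tail; auto. apply Rinv_0_lt_compat, lt_0_INR. lia. }
    pose (Lf := fun n => proj1_sig (constructive_indefinite_description _ (HC n))).
    assert (HLf : forall n (A : list nat -> Prop), (forall t, A t -> ~ In t (Lf n)) ->
      nle d (restr A x) (/ INR (S n))).
    { intros n. exact (proj2_sig (constructive_indefinite_description _ (HC n))). }
    assert (HS : forall n, nle d (vsub x (restr (fun t => In t (Lf n)) x)) (/ INR (S n))).
    { intros n. apply nle_mono with (restr (fun t => ~ In t (Lf n)) x); [|apply HLf; auto].
      intros t _. unfold vsub. right. f_equal. destruct (classic (In t (Lf n))).
      - rewrite restr_in, restr_out by tauto. ring.
      - rewrite restr_out, restr_in by tauto. ring. }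
    exists (fun n => restr (fun t => In t (Lf n)) x). repeat split.
    + intros t Ht. unfold restr. rewrite H0 by auto. destruct (pb _); auto.
    + exists (Lf n). intros t Ht. apply restr_out; auto.
    + intros n. apply bound_nle. eauto.
    + intros eps He. destruct (archimed_cor1 eps He) as [N [HN HN0]].
      exists N. intros n Hn. unfold R_dist. rewrite Rminus_0_r.
      rewrite Rabs_pos_eq by (apply Xnorm_nonneg; eauto).
      eapply Rle_lt_trans; [apply Xnorm_le, HS|].
      eapply Rle_lt_trans; [|apply HN]. apply Rinv_le_contravar.
      * apply lt_0_INR; auto.
      * apply le_INR. lia.
Qed.

Lemma inX_bounded (d : nat) (x : vec) : inX d x -> exists B, nle d x B.
Proof. intros H. apply inX_iff in H. tauto. Qed.

Lemma inX_supp (d : nat) (x : vec) (t : list nat) : inX d x -> ~ subsetN d t -> x t = 0.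
Proof. intros [H _]. apply H. Qed.

Lemma inX_nle (d : nat) (x : vec) : inX d x -> nle d x (Xnorm d x).
Proof. intros H. apply nle_Xnorm, inX_bounded, H. Qed.

Lemma inX_add (d : nat) (x y : vec) : inX d x -> inX d y -> inX d (vadd x y).
Proof.
  rewrite !inX_iff. intros [H1 [A HA]] [H2 [B HB]]. split.
  - intros t Ht. unfold vadd. rewrite H1, H2 by auto. ring.
  - exists (A + B). apply nle_add; auto.
Qed.

Lemma inX_scale (d : nat) (c : R) (x : vec) : inX d x -> inX d (vscale c x).
Proof.
  rewrite !inX_iff. intros [H1 [A HA]]. split.
  - intros t Ht. unfold vscale. rewrite H1 by auto. ring.
  - exists (Rabs c * A). apply nle_scale; auto.
Qed.

Lemma inX_restr (d : nat) (A : list nat -> Prop) (x : vec) : inX d x -> inX d (restr A x).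
Proof.
  rewrite !inX_iff. intros [H1 [B HB]]. split.
  - intros t Ht. unfold restr. rewrite H1 by auto. destruct (pb _); auto.
  - exists B. eapply nle_mono; [|apply HB]. intros. apply restr_Rabs_le.
Qed.

Lemma inX_finite (d : nat) (x : vec) (L : list (list nat)) :
  (forall t, In t L -> subsetN d t) -> (forall t, ~ In t L -> x t = 0) -> inX d x.
Proof.
  intros H1 H2. apply inX_iff. split.
  - intros t Ht. apply H2. auto.
  - exists (fam_l1 x L). apply nle_finite; auto.
Qed.

(** * Products of finite sets *)

Fixpoint prodl (Fs : list (list nat)) : list (list nat) :=
  match Fs with
  | [] => [[]]
  | F :: Fs' => flat_map (fun a => map (cons a) (prodl Fs')) F
  end.

Lemma in_prodl (Fs : list (list nat)) (t : list nat) :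
  In t (prodl Fs) <-> Forall2 (fun a F => In a F) t Fs.
Proof.
  revert t. induction Fs as [|F Fs IH]; intros t; simpl.
  - split; [intros [<-|[]]; constructor|]. intros H. inversion H. auto.
  - rewrite in_flat_map. split.
    + intros [a [Ha Ht]]. apply in_map_iff in Ht. destruct Ht as [t' [<- Ht']].
      constructor; auto. apply IH; auto.
    + intros H. inversion H as [|a F' t' Fs' H1 H2]; subst. exists a. split; auto.
      apply in_map. apply IH; auto.
Qed.

Definition bounded_lists (j A : nat) : list (list nat) := prodl (repeat (seq 0 (S A)) j).

Lemma in_bounded_lists (j A : nat) (t : list nat) :
  length t = j -> (forall a, In a t -> (a <= A)%nat) -> In t (bounded_lists j A).
Proof.
  intros <- H. apply in_prodl. induction t as [|a t IH]; cbn [length repeat]; constructor.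
  - apply in_seq. specialize (H a (or_introl eq_refl)). lia.
  - apply IH. intros; apply H; simpl; auto.
Qed.

Lemma finite_eventually {B : Type} (l : list B) (Phi : B -> nat -> Prop) :
  (forall b, In b l -> exists p0, forall p, (p0 <= p)%nat -> Phi b p) ->
  exists p0, forall b p, In b l -> (p0 <= p)%nat -> Phi b p.
Proof.
  induction l as [|b l IH]; intros H.
  - exists 0%nat. simpl. tauto.
  - destruct (H b (or_introl eq_refl)) as [p1 H1].
    destruct IH as [p2 H2]; [intros; apply H; simpl; auto|].
    exists (Nat.max p1 p2). intros b' p [<-|Hb'] Hp; [apply H1|apply H2]; auto; lia.
Qed.

(** * Small gaps *)

Definition entry_in (l p q : nat) (t : list nat) : Prop := (p < nth l t 0 <= q)%nat.

(* Otherwise, for any [N], some [y s] would have [N] pieces of norm greater than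
   [delta] on pairwise disjoint sets, and the lower l2-estimate would give
   [N * delta ^ 2 <= C ^ 2]. *)
Lemma gap_small_coord {T : Type} (d : nat) (W : (T -> Prop) -> Prop) (y : T -> vec)
    (C delta : R) (l : nat) :
  ultra W -> (forall s, nle d (y s) C) -> 0 < delta ->
  exists p0, forall p, (p0 <= p)%nat -> forall q,
    W (fun s => nle d (restr (entry_in l p q) (y s)) delta).
Proof.
  intros HW HC Hd. apply NNPP. intros Hn.
  assert (HB : forall p0, exists p q, (p0 <= p)%nat /\
    W (fun s => exists Ps, admissible d Ps /\
         delta ^ 2 <= Q2 (restr (entry_in l p q) (y s)) Ps)).
  { intros p0. apply NNPP. intros Hn'. apply Hn. exists p0. intros p Hp q.
    destruct (ultra_em W (fun s => nle d (restr (entry_in l p q) (y s)) delta) HW)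
      as [H|H]; auto.
    exfalso. apply Hn'. exists p, q. split; auto. apply ultra_mono with (3 := H); auto.
    intros s Hs. apply NNPP. intros HN. apply Hs. intros Ps HP.
    apply Qval_le_iff; [lra|]. apply Rnot_lt_le. intros Hlt. apply HN. exists Ps.
    split; auto. lra. }
  (* The pieces move outwards: [b] bounds the [l]-th entries used so far and the next gap starts at
     some [p >= b], so the new families are disjoint from the old ones. *)
  assert (HN : forall N : nat, exists b, W (fun s => exists Ps, admissible d Ps /\
    (forall P t, In P Ps -> In t P -> (nth l t 0 <= b)%nat) /\
    INR N * delta ^ 2 <= Q2 (y s) Ps)).
  { induction N as [|N [b IH]].
    - exists 0%nat. apply ultra_all; auto. intros s. exists []. split.
      + apply admissible_nil.
      + split; [simpl; tauto|]. rewrite Rmult_0_l. apply Q2_nonneg.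
    - destruct (HB b) as [p [q [Hp Hq]]]. exists (Nat.max b q).
      apply ultra_mono with (3 := ultra_and W _ _ HW IH Hq); auto.
      intros s [[Ps [H1 [H2 H3]]] [Ps' [H1' H3']]].
      exists (Ps ++ restrict_fams (entry_in l p q) Ps'). split; [|split].
      + apply admissible_app_restrict; auto. intros P t HP Ht [H4 _].
        specialize (H2 P t HP Ht). lia.
      + intros P t HP Ht. apply in_app_or in HP. destruct HP as [HP|HP].
        * specialize (H2 P t HP Ht). lia.
        * apply in_map_iff in HP. destruct HP as [P' [<- HP']].
          apply filter_In in Ht. destruct Ht as [_ Ht].
          apply (proj1 (pb_true _)) in Ht. destruct Ht. lia.
      + rewrite Q2_app, Q2_restrict, S_INR. lra. }
  destruct (INR_unbounded (C ^ 2 / delta ^ 2)) as [N HNb].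
  destruct (HN N) as [b Hb]. destruct (ultra_ex W _ HW Hb) as [s [Ps [HP [_ HQ]]]].
  pose proof (nle_Q2 _ _ _ _ (HC s) HP) as H.
  assert (0 < delta ^ 2) by (apply pow_lt; auto).
  apply (Rmult_lt_compat_r (delta ^ 2)) in HNb; auto.
  unfold Rdiv in HNb. rewrite Rmult_assoc, Rinv_l in HNb by lra. lra.
Qed.

Definition small_gap (d : nat) (delta : R) (y : vec) (p q : nat) : Prop :=
  forall l, (l < d)%nat -> nle d (restr (entry_in l p q) y) delta.

Lemma gap_small {T : Type} (d : nat) (W : (T -> Prop) -> Prop) (y : T -> vec)
    (C delta : R) :
  ultra W -> (forall s, nle d (y s) C) -> 0 < delta ->
  exists p0, forall p, (p0 <= p)%nat -> forall q, W (fun s => small_gap d delta (y s) p q).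
Proof.
  intros HW HC Hd.
  destruct (finite_eventually (seq 0 d) (fun l p => forall q,
    W (fun s => nle d (restr (entry_in l p q) (y s)) delta))) as [p0 Hp0].
  { intros l _. eapply gap_small_coord; eauto. }
  exists p0. intros p Hp q.
  apply ultra_mono with (fun s => forall l, In l (seq 0 d) ->
    nle d (restr (entry_in l p q) (y s)) delta); auto.
  - intros s H l Hl. apply H, in_seq. lia.
  - apply ultra_forall_in; auto.
Qed.

(** * Selection of a sparse set *)

(* Index sets are listed in decreasing order, so that prolonging a tuple is [cons];
   [hd 0 be] is then the last index used so far, and the matching tuple of values
   is [rev_append (map n be) tau]. *)
Fixpoint decr (al : list nat) : Prop :=
  match al with
  | [] => True
  | b :: be => (hd 0 be < b)%nat /\ decr be
  end.

(** Between an index and the next index [b] the gap runs from the cut at the former ([0] at the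
    start) to the cut at [b - 1]. Up to the last index, only the blocks from [q (b - 1)] to [q b]
    remain uncovered. *)
Fixpoint gaps (Good : list nat -> nat -> nat -> Prop) (q : nat -> nat)
    (al s : list nat) : Prop :=
  match al with
  | [] => True
  | b :: be => gaps Good q be s /\ Good s (q (hd 0%nat be)) (q (b - 1)%nat)
  end.

Lemma decr_le (al : list nat) (a : nat) : decr al -> In a al -> (a <= hd 0 al)%nat.
Proof.
  induction al as [|b be IH]; simpl; [tauto|]. intros [H1 H2] [<-|Ha]; auto.
  specialize (IH H2 Ha). lia.
Qed.

Lemma gaps_ext (Good : list nat -> nat -> nat -> Prop) (q q' : nat -> nat)
    (A : nat) (al s : list nat) :
  (forall a, (a <= A)%nat -> q a = q' a) -> decr al -> (hd 0 al <= A)%nat ->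
  gaps Good q al s -> gaps Good q' al s.
Proof.
  intros Hq. induction al as [|b be IH]; simpl; auto.
  intros [H1 H2] Hb [H3 H4]. split; [apply IH; auto; lia|].
  rewrite <- !Hq by lia. auto.
Qed.

(** Induction on [A]. All index tuples up to [A] are kept extendable: [Uq]-many completions of the
    chosen values satisfy the requirements made so far, and so does the gap that starts at the last
    cut, whatever its end. First the next value is chosen, then the next cut. *)
Lemma selection (U : (nat -> Prop) -> Prop) (k : nat)
    (Good : list nat -> nat -> nat -> Prop) (Base : list nat -> Prop) (q0 Lmin A : nat) :
  ultra U -> (forall N, U (fun n => (N < n)%nat)) ->
  (forall sigma r, (length sigma + r = k)%nat -> exists p0, forall p, (p0 <= p)%nat ->
     forall q, Uq U r (fun tau => Good (rev_append sigma tau) p q)) ->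
  Uq U k Base -> (forall q, Uq U k (fun s => Good s q0 q)) ->
  exists n q : nat -> nat,
    q 0%nat = q0 /\
    (forall a, (a < A)%nat -> (q a < q (S a))%nat) /\
    (forall a, (a < A)%nat -> (n a < n (S a))%nat) /\
    (forall a, (Lmin <= n a)%nat) /\
    forall al r, decr al -> (hd 0 al <= A)%nat -> (length al + r = k)%nat ->
      Uq U r (fun tau => Base (rev_append (map n al) tau) /\
                         gaps Good q al (rev_append (map n al) tau)) /\
      forall b, Uq U r (fun tau => Good (rev_append (map n al) tau) (q (hd 0%nat al)) b).
Proof.
  intros HU HF HG HB H0. induction A as [|A IH].
  - exists (fun _ => Lmin), (fun _ => q0). repeat split; try lia.
    + destruct al as [|b be]; [|simpl in *; lia]. simpl in H2. subst r. simpl.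
      apply ultra_mono with (3 := HB); auto using ultra_Uq.
    + destruct al as [|b be]; [|simpl in *; lia]. simpl in H2. subst r. simpl. auto.
  - destruct IH as [n [q [E0 [Hq [Hn [HL HI]]]]]].
    set (LB := concat (map (fun j => bounded_lists j A) (seq 0 k))).
    assert (HLB : forall be, decr be -> (hd 0 be <= A)%nat -> (length be < k)%nat ->
      In be LB).
    { intros be H1 H2 H3. apply in_concat. exists (bounded_lists (length be) A). split.
      - apply (in_map (fun j => bounded_lists j A)). apply in_seq. lia.
      - apply in_bounded_lists; auto. intros a Ha. pose proof (decr_le _ _ H1 Ha). lia. }
    (* With [S r] entries free, [Uq] unfolds to [U]-many values [n'] of the next entry with [r]
       still free. There are finitely many prefixes [be], so one [n'] serves them all. *)
    assert (HN : U (fun n' => forall be, In be LB -> decr be -> (hd 0 be <= A)%nat ->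
      forall r, (length be + S r = k)%nat ->
      Uq U r (fun tau => let s := rev_append (map n be) (n' :: tau) in
        (Base s /\ gaps Good q be s) /\ Good s (q (hd 0%nat be)) (q A)))).
    { apply ultra_forall_in; auto. intros be _.
      destruct (classic (decr be /\ (hd 0 be <= A)%nat /\ (length be < k)%nat))
        as [[H1 [H2 H3]]|Hc].
      - destruct (HI be (S (k - length be - 1)) H1 H2 ltac:(lia)) as [H4 H5].
        specialize (H5 (q A)).
        pose proof (ultra_and _ _ _ (ultra_Uq U (S (k - length be - 1)) HU) H4 H5) as H6.
        simpl in H6. apply ultra_mono with (3 := H6); auto. intros n' H7 _ _ r Hr.
        replace r with (k - length be - 1)%nat by lia. exact H7.
      - apply ultra_all; auto. intros n' H1 H2 r Hr. exfalso. apply Hc.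
        repeat split; auto. lia. }
    destruct (ultra_ex U _ HU (ultra_and U _ _ HU HN (HF (Nat.max (n A) Lmin))))
      as [n' [Hn' Hn'']].
    (* The cut is chosen after [n'], because the threshold for small gaps depends on the prefix,
       which now contains [n']. *)
    destruct (finite_eventually LB (fun be p => forall r, (length be + S r = k)%nat ->
      forall b, Uq U r (fun tau => Good (rev_append (n' :: map n be) tau) p b)))
      as [p0 Hp0].
    { intros be _. destruct (classic (length be < k)%nat) as [Hl|Hl].
      - destruct (HG (n' :: map n be) (k - length be - 1)%nat) as [p0 Hp0].
        { simpl. rewrite length_map. lia. }
        exists p0. intros p Hp r Hr b. replace r with (k - length be - 1)%nat by lia. auto.
      - exists 0%nat. intros p _ r Hr. lia. }
    set (q' := Nat.max p0 (S (q A))).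
    set (n2 := fun a => if (a =? S A)%nat then n' else n a).
    set (q2 := fun a => if (a =? S A)%nat then q' else q a).
    assert (En : forall a, (a <= A)%nat -> n a = n2 a).
    { intros a Ha. unfold n2. destruct (Nat.eqb_spec a (S A)); auto; lia. }
    assert (Eq : forall a, (a <= A)%nat -> q a = q2 a).
    { intros a Ha. unfold q2. destruct (Nat.eqb_spec a (S A)); auto; lia. }
    assert (EnS : n2 (S A) = n') by (unfold n2; rewrite Nat.eqb_refl; auto).
    assert (EqS : q2 (S A) = q') by (unfold q2; rewrite Nat.eqb_refl; auto).
    assert (Em : forall al, decr al -> (hd 0 al <= A)%nat -> map n2 al = map n al).
    { intros al H1 H2. apply map_ext_in. intros a Ha. symmetry. apply En.
      pose proof (decr_le _ _ H1 Ha). lia. }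
    exists n2, q2. split; [|split; [|split; [|split]]].
    + rewrite <- Eq by lia. auto.
    + intros a Ha. destruct (Nat.eq_dec a A) as [->|Ne].
      * rewrite EqS, <- Eq by lia. unfold q'. lia.
      * rewrite <- !Eq by lia. apply Hq. lia.
    + intros a Ha. destruct (Nat.eq_dec a A) as [->|Ne].
      * rewrite EnS, <- En by lia. lia.
      * rewrite <- !En by lia. apply Hn. lia.
    + intros a. unfold n2. destruct (a =? S A)%nat; auto. lia.
    (* Tuples of old indices keep their properties; every other tuple has head [S A]. *)
    + intros al r H1 H2 H3. destruct (classic (hd 0 al <= A)%nat) as [H4|H4].
      * rewrite Em, <- Eq by auto. destruct (HI al r H1 H4 H3) as [H5 H6].
        split; auto. apply ultra_mono with (3 := H5); auto using ultra_Uq.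
        intros tau [H7 H8]. split; auto. apply gaps_ext with q A; auto.
      * destruct al as [|b be]; [simpl in H4; lia|]. simpl in H1, H2, H3, H4.
        destruct H1 as [H1 H1']. assert (b = S A) as -> by lia.
        assert (Hin : In be LB) by (apply HLB; auto; lia).
        cbn [map hd rev_append]. rewrite EnS, EqS, Em by (auto; lia). split.
        -- apply ultra_mono with (3 := Hn' be Hin H1' ltac:(lia) r ltac:(lia));
             auto using ultra_Uq.
           intros tau [[H5 H6] H7]. split; auto. cbn [gaps]. split.
           ++ apply gaps_ext with q A; auto; lia.
           (* The gap before the index [S A] ends at the last old cut, the one used in choosing
              [n']. *)
           ++ rewrite <- !Eq by lia. replace (S A - 1)%nat with A by lia. exact H7.
        -- apply (Hp0 be q' Hin ltac:(unfold q'; lia) r ltac:(lia)).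
Qed.

(** * Plegma families in a sparse set *)

(* [pos m i j] is the index of the [j]-th entry of the [i]-th member of the plegma
   family, for [1 <= j]; the value at [j = 0] is the starting index [0]. *)
Definition pos (m i j : nat) : nat := match j with O => O | S j' => (j' * m + i)%nat end.

Fixpoint indices (m i j : nat) : list nat :=
  match j with O => [] | S j' => pos m i j :: indices m i j' end.

(** The values at [i], [m + i], [2 m + i], and so on: for [i = 1, ..., m] these tuples interlace as
    a plegma family. *)
Definition member (n : nat -> nat) (k m i : nat) : list nat :=
  map (fun j => n (j * m + i)%nat) (seq 0 k).

Lemma indices_hd (m i j : nat) : hd 0%nat (indices m i j) = pos m i j.
Proof. destruct j; reflexivity. Qed.

Lemma indices_length (m i j : nat) : length (indices m i j) = j.
Proof. induction j; simpl; auto. Qed.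

Lemma indices_decr (m i j : nat) : (1 <= i <= m)%nat -> decr (indices m i j).
Proof.
  intros Hi. induction j; simpl; auto. split; auto. rewrite indices_hd.
  destruct j; simpl; lia.
Qed.

Lemma indices_member (n : nat -> nat) (m i j : nat) :
  rev_append (map n (indices m i j)) [] = member n j m i.
Proof.
  rewrite rev_append_rev, app_nil_r. unfold member. induction j as [|j IH]; auto.
  rewrite seq_S, map_app, <- IH. reflexivity.
Qed.

Lemma gaps_indices Good q m i j s :
  gaps Good q (indices m i j) s ->
  forall j', (j' < j)%nat -> Good s (q (pos m i j')) (q (pos m i (S j') - 1)%nat).
Proof.
  induction j as [|j IH]; intros H j' Hj'; [lia|]. cbn [indices gaps] in H.
  destruct H as [H1 H2]. rewrite indices_hd in H2.
  destruct (Nat.eq_dec j' j) as [->|Ne]; auto. apply IH; auto. lia.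
Qed.

(** * Blocks, and the number of main parts that one family can meet *)

Definition in_block (q : nat -> nat) (m i j a : nat) : Prop :=
  (q (pos m i (S j) - 1) < a <= q (pos m i (S j)))%nat.

Lemma increasing_le (f : nat -> nat) (A a b : nat) :
  (forall c, (c < A)%nat -> (f c < f (S c))%nat) -> (a <= b <= A)%nat -> (f a <= f b)%nat.
Proof.
  intros H [H1 H2]. induction H1 as [|b H1 IH]; auto.
  specialize (H b H2). specialize (IH ltac:(lia)). lia.
Qed.

Lemma increasing_lt (f : nat -> nat) (A a b : nat) :
  (forall c, (c < A)%nat -> (f c < f (S c))%nat) -> (a < b <= A)%nat -> (f a < f b)%nat.
Proof.
  intros H H1. pose proof (increasing_le f A (S a) b H ltac:(lia)).
  specialize (H a ltac:(lia)). lia.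
Qed.

(** Uniqueness of division by [m] with remainders in [1, ..., m]. *)
Lemma pos_inj (m i i' j j' : nat) :
  (1 <= i <= m)%nat -> (1 <= i' <= m)%nat -> pos m i (S j) = pos m i' (S j') -> i = i'.
Proof.
  simpl. intros H1 H2 H.
  assert (j = j') as ->; [|lia].
  destruct (Nat.lt_trichotomy j j') as [Hl|[->|Hl]]; auto; exfalso; nia.
Qed.

Lemma pos_le (k m i j : nat) :
  (1 <= i <= m)%nat -> (j < k)%nat -> (1 <= pos m i (S j) <= k * m)%nat.
Proof. simpl. intros. nia. Qed.

(** Blocks at different positions are separated by a cut, so a common entry forces equal
    positions. *)
Lemma in_block_disjoint (k m i i' j j' a : nat) (q : nat -> nat) :
  (forall c, (c < k * m)%nat -> (q c < q (S c))%nat) ->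
  (1 <= i <= m)%nat -> (1 <= i' <= m)%nat -> (j < k)%nat -> (j' < k)%nat ->
  in_block q m i j a -> in_block q m i' j' a -> i = i'.
Proof.
  intros Hq Hi Hi' Hj Hj' H H'. apply pos_inj with m j j'; auto.
  pose proof (pos_le k m i j Hi Hj). pose proof (pos_le k m i' j' Hi' Hj').
  unfold in_block in *.
  destruct (Nat.lt_trichotomy (pos m i (S j)) (pos m i' (S j'))) as [Hl|[E|Hl]]; auto.
  - pose proof (increasing_le q (k * m) (pos m i (S j)) (pos m i' (S j') - 1) Hq
      ltac:(lia)). lia.
  - pose proof (increasing_le q (k * m) (pos m i' (S j')) (pos m i (S j) - 1) Hq
      ltac:(lia)). lia.
Qed.

Lemma incrb_nth_le (s : list nat) (i j : nat) :
  incrb s = true -> (i <= j < length s)%nat -> (nth i s 0 <= nth j s 0)%nat.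
Proof.
  intros H [H1 H2]. induction H1 as [|j H1 IH]; auto.
  pose proof (incrb_nth_S s j H ltac:(lia)) as H3.
  rewrite Nat.add_1_r in H3. specialize (IH ltac:(lia)). lia.
Qed.

(* Pigeonhole: [k + 1] entries distributed over [k] blocks. *)
Lemma two_entries_same_block (k m i : nat) (q : nat -> nat) (t : list nat) :
  (forall c, (c < k * m)%nat -> (q c < q (S c))%nat) -> (1 <= i <= m)%nat ->
  incrb t = true -> length t = S k ->
  (forall l, (l <= k)%nat -> exists j, (j < k)%nat /\ in_block q m i j (nth l t 0%nat)) ->
  exists l j, (l < k)%nat /\ (j < k)%nat /\
    in_block q m i j (nth l t 0%nat) /\ in_block q m i j (nth (l + 1) t 0%nat).
Proof.
  intros Hq Hi Ht Hlen Hb. apply NNPP. intros Hn.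
  (* If no two consecutive entries share a block, the [l]-th entry lies in a block of number at
     least [l]; for [l = k] there is none. *)
  assert (HI : forall l, (l <= k)%nat -> forall j, (j < k)%nat ->
    in_block q m i j (nth l t 0%nat) -> (l <= j)%nat).
  { induction l as [|l IH]; intros Hl j Hj HB; [lia|].
    destruct (Hb l ltac:(lia)) as [j' [Hj' HB']].
    specialize (IH ltac:(lia) j' Hj' HB').
    destruct (Nat.lt_trichotomy j j') as [Hlt|[->|Hlt]]; [| |lia].
    - exfalso. pose proof (incrb_nth_S t l Ht ltac:(lia)) as H1.
      rewrite Nat.add_1_r in H1. unfold in_block in *.
      assert (pos m i (S j) <= pos m i (S j') - 1)%nat by (simpl; nia).
      pose proof (pos_le k m i j' Hi Hj').
      pose proof (increasing_le q (k * m) (pos m i (S j)) (pos m i (S j') - 1) Hq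
        ltac:(lia)). lia.
    - exfalso. apply Hn. exists l, j'. rewrite Nat.add_1_r. auto. }
  destruct (Hb k (le_n k)) as [j [Hj HB]]. specialize (HI k (le_n k) j Hj HB). lia.
Qed.

(* A Schreier plegmatic family meeting the [i]-th main part in a tuple [t] either has
   [t(1) <= q 0], hence at most [q 0] last entries, or else [t] has two consecutive
   entries [l], [l + 1] in one block, and no other main part can use the same [l]. *)
Lemma main_count (k m : nat) (q : nat -> nat) (P : list (list nat)) (I : list nat) :
  (forall c, (c < k * m)%nat -> (q c < q (S c))%nat) ->
  schreier_plegmatic (S k) P -> NoDup I ->
  (forall i, In i I -> (1 <= i <= m)%nat /\ exists t, In t P /\
     (q 0 < nth k t 0)%nat /\
     forall l, (l <= k)%nat -> (nth l t 0 <= q 0)%nat \/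
       exists j, (j < k)%nat /\ in_block q m i j (nth l t 0%nat)) ->
  (length I <= q 0 + k)%nat.
Proof.
  intros Hq [F [[HP [HF1 [HF2 [HF3 HF4]]]] HF5]] HI H.
  assert (HT : forall i, exists t, In i I -> In t P /\
     (q 0 < nth k t 0)%nat /\
     forall l, (l <= k)%nat -> (nth l t 0 <= q 0)%nat \/
       exists j, (j < k)%nat /\ in_block q m i j (nth l t 0%nat)).
  { intros i. destruct (classic (In i I)) as [Hi|Hi].
    - destruct (H i Hi) as [_ [t Ht]]. exists t. auto.
    - exists []. tauto. }
  apply choice in HT. destruct HT as [T HT].
  assert (Hm : forall i, In i I -> (1 <= i <= m)%nat) by (intros i Hi; apply H, Hi).
  clear H.
  set (lo := fun i => (nth 0 (T i) 0 <=? q 0)%nat).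
  (* One first entry at most [q 0] bounds the size of [F_1] by the Schreier condition, and [F_(k+1)]
     has the same size. The last entries of these tuples lie in blocks of different members, hence
     are distinct elements of [F_(k+1)]. *)
  assert (E1 : (length (filter lo I) <= q 0)%nat).
  { destruct (filter lo I) as [|i0 I0] eqn:EI; [simpl; lia|].
    assert (Hi0 : In i0 (filter lo I)) by (rewrite EI; left; auto).
    rewrite <- EI. clear EI I0. apply filter_In in Hi0. destruct Hi0 as [Hi0 Hlo].
    apply Nat.leb_le in Hlo. destruct (HT i0 Hi0) as [Ht0 _].
    pose proof (HF5 _ (HF4 _ Ht0 0%nat ltac:(lia))) as HF0.
    destruct (HF2 k ltac:(lia)) as [_ HF6].
    apply Nat.le_trans with (length (nth k F [])); [|lia].
    rewrite <- (length_map (fun i => nth k (T i) 0%nat)). apply NoDup_incl_length.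
    - apply NoDup_map_NoDup_ForallPairs; [|apply NoDup_filter; auto].
      intros i i' Hi Hi' E. apply filter_In in Hi, Hi'.
      destruct Hi as [Hi _], Hi' as [Hi' _].
      destruct (HT i Hi) as [_ [H1 H2]], (HT i' Hi') as [_ [H1' H2']].
      destruct (H2 k (le_n k)) as [H3|[j [Hj H3]]]; [lia|].
      destruct (H2' k (le_n k)) as [H3'|[j' [Hj' H3']]]; [lia|].
      rewrite <- E in H3'. apply in_block_disjoint with (6 := H3) (7 := H3') (k := k); auto.
    - intros a Ha. apply in_map_iff in Ha. destruct Ha as [i [<- Hi]].
      apply filter_In in Hi. destruct Hi as [Hi _]. apply HF4; [|lia].
      apply HT; auto. }
  assert (HL : forall i, exists l, In i (filter (fun i => negb (lo i)) I) ->
    (l < k)%nat /\ exists j, (j < k)%nat /\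
    in_block q m i j (nth l (T i) 0%nat) /\ in_block q m i j (nth (l + 1) (T i) 0%nat)).
  { intros i. destruct (classic (In i (filter (fun i => negb (lo i)) I))) as [Hi|Hi].
    - pose proof Hi as Hi'. apply filter_In in Hi'. destruct Hi' as [Hi1 Hi2].
      apply negb_true_iff, Nat.leb_gt in Hi2. destruct (HT i Hi1) as [H1 [H2 H3]].
      destruct (HP _ H1) as [H4 [H5 _]].
      destruct (two_entries_same_block k m i q (T i) Hq (Hm i Hi1) H5 H4)
        as [l [j [H6 [H7 H8]]]].
      + intros l Hl. destruct (H3 l Hl) as [H6|H6]; auto.
        pose proof (incrb_nth_le (T i) 0 l H5 ltac:(lia)). lia.
      + exists l. intros _. split; auto. exists j. auto.
    - exists 0%nat. tauto. }
  apply choice in HL. destruct HL as [lab HL].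
  assert (E2 : (length (filter (fun i => negb (lo i)) I) <= k)%nat).
  { rewrite <- (length_map lab). replace k with (length (seq 0 k)) by apply length_seq.
    apply NoDup_incl_length.
    - apply NoDup_map_NoDup_ForallPairs; [|apply NoDup_filter; auto].
      intros i i' Hi Hi' E. destruct (HL i Hi) as [Hl [j [Hj [HB1 HB2]]]].
      destruct (HL i' Hi') as [Hl' [j' [Hj' [HB1' HB2']]]]. rewrite <- E in *.
      apply filter_In in Hi, Hi'. destruct Hi as [Hi _], Hi' as [Hi' _].
      destruct (HT i Hi) as [HP1 _], (HT i' Hi') as [HP1' _].
      apply pos_inj with m j j'; auto.
      pose proof (pos_le k m i j (Hm i Hi) Hj).
      pose proof (pos_le k m i' j' (Hm i' Hi') Hj').
      unfold in_block in *.
      (* Equal labels put the two pairs of entries into the same [F_l < F_(l+1)]. If the blocks were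
         different, entry [l] in the later block would exceed entry [l + 1] in the earlier one. *)
      assert (F1 : (nth (lab i) (T i) 0 < nth (lab i + 1) (T i') 0)%nat)
        by (apply HF3 with (lab i); [lia| |]; apply HF4; auto; lia).
      assert (F2 : (nth (lab i) (T i') 0 < nth (lab i + 1) (T i) 0)%nat)
        by (apply HF3 with (lab i); [lia| |]; apply HF4; auto; lia).
      destruct (Nat.lt_trichotomy (pos m i (S j)) (pos m i' (S j'))) as [Hlt|[E'|Hlt]]; auto.
      + pose proof (increasing_le q (k * m) (pos m i (S j)) (pos m i' (S j') - 1) Hq
          ltac:(lia)). lia.
      + pose proof (increasing_le q (k * m) (pos m i' (S j')) (pos m i (S j) - 1) Hq
          ltac:(lia)). lia.
    - intros a Ha. apply in_map_iff in Ha. destruct Ha as [i [<- Hi]].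
      apply in_seq. destruct (HL i Hi). lia. }
  pose proof (filter_length lo I). lia.
Qed.

(** After the last index there is no next cut; [qe], a bound for all entries in question, stands for
    infinity. *)
Definition gap_end (k m : nat) (q : nat -> nat) (qe i j : nat) : nat :=
  if (j <? k)%nat then q (pos m i (S j) - 1)%nat else qe.

(** Walking up the cuts: an entry outside all gaps and blocks lies beyond the cut at each index,
    hence in the last gap after all. *)
Lemma find_block (k m i qe a : nat) (q : nat -> nat) :
  (q 0 < a <= qe)%nat ->
  (forall j, (j <= k)%nat -> ~ (q (pos m i j) < a <= gap_end k m q qe i j)%nat) ->
  exists j, (j < k)%nat /\ in_block q m i j a.
Proof.
  intros Ha Hg. apply NNPP. intros Hn.
  assert (H : forall j, (j <= k)%nat -> (q (pos m i j) < a)%nat).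
  { induction j as [|j IH]; intros Hj; [simpl; lia|].
    specialize (IH ltac:(lia)). apply Nat.nle_gt. intros Hle. apply Hn. exists j.
    split; [lia|]. split; auto. specialize (Hg j ltac:(lia)). unfold gap_end in Hg.
    destruct (Nat.ltb_spec j k); lia. }
  specialize (Hg k (le_n k)). specialize (H k (le_n k)). unfold gap_end in Hg.
  rewrite Nat.ltb_irrefl in Hg. lia.
Qed.

(** * Averages of small norm along plegma families *)

Lemma entries_bounded (ll : list (list nat)) :
  exists b, forall t l, In t ll -> (nth l t 0 <= b)%nat.
Proof.
  exists (list_max (concat ll)). intros t l Ht.
  destruct (Nat.lt_ge_cases l (length t)) as [Hl|Hl].
  - assert (H : (list_max (concat ll) <= list_max (concat ll))%nat) by lia.
    apply list_max_le in H. rewrite Forall_forall in H. apply H.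
    apply in_concat. exists t. split; auto. apply nth_In; auto.
  - rewrite nth_overflow by auto. lia.
Qed.

(** On each family at most [K] of the [w i] contribute, so Cauchy-Schwarz costs a factor [K] instead
    of [m]. Summing over the families bounds the squares by [m C^2], against the factor [m^(-2)]
    from the coefficients. *)
Lemma main_part_norm (m K : nat) (C : R) (w : nat -> vec) (a : nat -> R)
    (Ps : list (list (list nat))) :
  (1 <= m)%nat -> (forall i, Rabs (a i) <= / INR m) ->
  (forall i, Q2 (w i) Ps <= C ^ 2) ->
  (forall P I, In P Ps -> NoDup I ->
     (forall i, In i I -> (1 <= i <= m)%nat /\ exists t, In t P /\ w i t <> 0) ->
     (length I <= K)%nat) ->
  Q2 (fun t => lsum (seq 1 m) (fun i => a i * w i t)) Ps <= INR K * C ^ 2 / INR m.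
Proof.
  intros Hm Ha HC HK. assert (Hm' : 0 < INR m) by (apply lt_0_INR; lia).
  assert (Hi : 0 < / INR m) by (apply Rinv_0_lt_compat; auto).
  assert (HP : forall P, In P Ps ->
    fam_l1 (fun t => lsum (seq 1 m) (fun i => a i * w i t)) P ^ 2 <=
    (/ INR m) ^ 2 * (INR K * lsum (seq 1 m) (fun i => fam_l1 (w i) P ^ 2))).
  { intros P HP. set (b := fun i => fam_l1 (w i) P).
    assert (Hb : forall i, 0 <= b i) by (intros; apply fam_l1_nonneg).
    apply Rle_trans with ((/ INR m * lsum (seq 1 m) b) ^ 2).
    - apply pow_incr. split; [apply fam_l1_nonneg|]. rewrite <- lsum_scal.
      unfold b. rewrite fam_l1_lsum.
      eapply Rle_trans; [apply lsum_le; intros; apply lsum_Rabs|].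
      rewrite lsum_exchange. apply lsum_le. intros i _. rewrite fam_l1_lsum, <- lsum_scal.
      apply lsum_le. intros t _. rewrite Rabs_mult.
      apply Rmult_le_compat_r; auto using Rabs_pos.
    - rewrite Rpow_mult_distr. apply Rmult_le_compat_l; [apply pow2_ge_0|].
      (* The indices whose vector has mass on [P]; dropping the others changes neither sum. *)
      set (I := filter (fun i => pb (b i <> 0)) (seq 1 m)).
      assert (EI : forall g : R -> R, g 0 = 0 ->
        lsum (seq 1 m) (fun i => g (b i)) = lsum I (fun i => g (b i))).
      { intros g Hg. unfold I. rewrite lsum_filter. apply lsum_ext. intros i _.
        destruct (pb (b i <> 0)) eqn:E; auto. apply (proj1 (pb_false _)) in E.
        apply NNPP in E. rewrite E. auto. }
      assert (EI1 : lsum (seq 1 m) b = lsum I b) by exact (EI (fun r => r) eq_refl).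
      assert (EI2 : lsum (seq 1 m) (fun i => fam_l1 (w i) P ^ 2) = lsum I (fun i => b i ^ 2))
        by (apply (EI (fun r => r ^ 2)); ring).
      rewrite EI1, EI2.
      eapply Rle_trans; [apply lsum_sq_le|]. apply Rmult_le_compat_r.
      + apply lsum_nonneg. intros; apply pow2_ge_0.
      + apply le_INR. apply HK with P; auto.
        * apply NoDup_filter, seq_NoDup.
        * intros i HI. apply filter_In in HI. destruct HI as [H1 H2].
          apply in_seq in H1. apply (proj1 (pb_true _)) in H2. split; [lia|].
          apply NNPP. intros Hn. apply H2. unfold b. rewrite fam_l1_lsum.
          apply lsum_zero. intros t Ht.
          rewrite (NNPP (w i t = 0)); [apply Rabs_R0|]. intros Hw. apply Hn. eauto. }
  eapply Rle_trans; [apply lsum_le, HP|].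
  rewrite lsum_scal, lsum_scal, lsum_exchange.
  apply Rle_trans with ((/ INR m) ^ 2 * (INR K * (INR m * C ^ 2))).
  - apply Rmult_le_compat_l; [apply pow2_ge_0|].
    apply Rmult_le_compat_l; [apply pos_INR|].
    rewrite <- (length_seq m 1) at 2. rewrite <- lsum_const. apply lsum_le.
    intros i _. apply HC.
  - right. field. lra.
Qed.

(** The average is cut into tuples below [q 0], tuples with an entry in a gap, and main parts; each
    costs [eta / 3]. The cancellation condition is only needed below [q 0]. It is met by
    coefficients of sum zero, and by all coefficients if [v = 0]. *)
Lemma small_plegma_averages (k : nat) (U : (nat -> Prop) -> Prop) (x : list nat -> vec)
    (C : R) (v : list nat -> R) (eta : R) :
  ultra U -> (forall N, U (fun n => (N < n)%nat)) ->
  (forall s, nle (S k) (x s) C) ->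
  (forall t eps, subsetN (S k) t -> 0 < eps ->
     Uq U k (fun s => Rabs (x s t - v t) <= eps)) ->
  0 < eta ->
  exists m0, forall m Lmin, (m0 <= m)%nat -> (1 <= m)%nat ->
  exists n : nat -> nat,
    (forall a, (a < k * m)%nat -> (n a < n (S a))%nat) /\
    (forall a, (Lmin <= n a)%nat) /\
    forall a : nat -> R, (forall i, Rabs (a i) <= / INR m) ->
      (forall t, subsetN (S k) t -> lsum (seq 1 m) a * v t = 0) ->
      nle (S k) (fun t => lsum (seq 1 m) (fun i => a i * x (member n k m i) t)) eta.
Proof.
  intros HU HF HC Hv He.
  (* Pairs of a gap and a position of an entry; [delta] divides [eta / 3] evenly among them. *)
  set (JL := list_prod (seq 0 (S k)) (seq 0 (S k))).
  assert (HJL : 0 < INR (length JL)).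
  { apply lt_0_INR. unfold JL. rewrite length_prod, !length_seq. lia. }
  set (delta := eta / 3 / INR (length JL)).
  assert (Hd : 0 < delta) by (unfold delta; apply Rdiv_lt_0_compat; lra).
  set (Good := fun s p q => small_gap (S k) delta (x s) p q).
  assert (HG : forall sigma r, exists p0, forall p, (p0 <= p)%nat ->
     forall q, Uq U r (fun tau => Good (rev_append sigma tau) p q)).
  { intros sigma r. unfold Good.
    apply (gap_small (S k) (Uq U r) (fun tau => x (rev_append sigma tau)) C delta); auto.
    apply ultra_Uq; auto. }
  (* The first cut is fixed before [m], so the count [q0 + k] of main parts does not grow with
     [m]. *)
  destruct (HG [] k) as [q0 Hq0].
  set (LL := filter (fun t => pb (subsetN (S k) t)) (bounded_lists (S k) q0)).
  set (eps := eta / 3 / (INR (length LL) + 1)).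
  assert (HLL : 0 <= INR (length LL)) by apply pos_INR.
  assert (Heps : 0 < eps) by (unfold eps; apply Rdiv_lt_0_compat; lra).
  set (Base := fun s => forall t, In t LL -> Rabs (x s t - v t) <= eps).
  assert (HB : Uq U k Base).
  { apply ultra_forall_in; [apply ultra_Uq; auto|]. intros t Ht. apply Hv; auto.
    apply filter_In in Ht. destruct Ht as [_ Ht]. apply (proj1 (pb_true _)), Ht. }
  (* From [m0] on, the bound [(q0 + k) C^2 / m] for the main parts is below [(eta / 3)^2]. *)
  destruct (INR_unbounded (INR (q0 + k) * C ^ 2 / (eta / 3) ^ 2)) as [m0 Hm0].
  exists m0. intros m Lmin Hm Hm1.
  assert (Hm' : 0 < INR m) by (apply lt_0_INR; lia).
  destruct (selection U k Good Base q0 Lmin (k * m) HU HF (fun s r _ => HG s r) HB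
    (Hq0 q0 (le_n q0))) as [n [q [E0 [Hq [Hn [HL HS]]]]]].
  exists n. split; [exact Hn|]. split; [exact HL|]. intros a Ha Hsum Ps HPs.
  assert (HI : forall i, (1 <= i <= m)%nat ->
    Base (member n k m i) /\
    (forall j, (j < k)%nat ->
       Good (member n k m i) (q (pos m i j)) (q (pos m i (S j) - 1)%nat)) /\
    forall b, Good (member n k m i) (q (pos m i k)) b).
  { intros i Hi. destruct (HS (indices m i k) 0%nat) as [H1 H2].
    - apply indices_decr; auto.
    - rewrite indices_hd. destruct k as [|k']; [simpl; lia|].
      apply (pos_le (S k') m i k' Hi). lia.
    - rewrite indices_length. lia.
    - cbn [Uq] in H1, H2. rewrite indices_member, indices_hd in H2.
      rewrite indices_member in H1. destruct H1 as [H1 H3]. split; [|split]; auto.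
      apply gaps_indices; auto. }
  clear HS.
  (* Only the finitely many tuples in [Ps] matter, so the last gap may end at a bound of their
     entries. *)
  destruct (entries_bounded (concat Ps)) as [qe Hqe].
  set (w := fun i => x (member n k m i)).
  set (low := fun t => forall l, (l <= k)%nat -> (nth l t 0 <= q 0)%nat).
  set (gap := fun i t => exists j l, (j <= k)%nat /\ (l <= k)%nat /\
    entry_in l (q (pos m i j)) (gap_end k m q qe i j) t).
  set (z1 := restr low (fun t => lsum (seq 1 m) (fun i => a i * w i t))).
  set (z2 := fun t => lsum (seq 1 m) (fun i =>
    a i * restr (fun t => ~ low t /\ gap i t) (w i) t)).
  set (z3 := fun t => lsum (seq 1 m) (fun i =>
    a i * restr (fun t => ~ low t /\ ~ gap i t) (w i) t)).
  assert (HZ : Qval (fun t => lsum (seq 1 m) (fun i => a i * w i t)) Ps <=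
    Qval z1 Ps + (Qval z2 Ps + Qval z3 Ps)).
  { eapply Rle_trans; [|apply Rplus_le_compat_l, Qval_triangle].
    eapply Rle_trans; [|apply Qval_triangle]. apply Qval_mono. intros P t _ _.
    right. f_equal. unfold vadd, z1, z2, z3. rewrite <- lsum_plus.
    destruct (classic (low t)) as [Hl|Hl].
    - rewrite restr_in by auto. rewrite (lsum_zero _ (fun i => _ + _)); [ring|].
      intros i _. rewrite !restr_out by tauto. ring.
    - rewrite restr_out by auto. rewrite Rplus_0_l. apply lsum_ext. intros i _.
      destruct (classic (gap i t)).
      + rewrite restr_in, restr_out by tauto. ring.
      + rewrite restr_out, restr_in by tauto. ring. }
  assert (H1 : Qval z1 Ps <= eta / 3).
  { apply Rle_trans with (fam_l1 z1 LL).
    - apply Qval_le_fam_l1 with (S k); auto. intros P t HP Ht Hz.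
      pose proof (admissible_subsetN _ _ _ _ HPs HP Ht) as Hs.
      apply filter_In. split; [|apply pb_true; auto].
      apply in_bounded_lists; [apply Hs|]. intros b Hb.
      destruct (classic (low t)) as [Hl|Hl].
      + apply (In_nth _ _ 0%nat) in Hb. destruct Hb as [l [Hl1 <-]].
        destruct Hs as [Hs _]. rewrite <- E0. apply Hl. lia.
      + exfalso. apply Hz. apply restr_out; auto.
    - rewrite fam_l1_lsum. apply Rle_trans with (lsum LL (fun _ => eps)).
      + apply lsum_le. intros t Ht. eapply Rle_trans; [apply restr_Rabs_le|].
        cbv beta. assert (Hs : subsetN (S k) t)
          by (apply filter_In in Ht; apply (proj1 (pb_true _)), Ht).
        (* As the coefficients cancel [v t], each [w i t] may be replaced by its deviation from
           [v t], which [Base] bounds by [eps]. *)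
        replace (lsum (seq 1 m) (fun i => a i * w i t)) with
          (lsum (seq 1 m) (fun i => a i * (w i t - v t))).
        * eapply Rle_trans; [apply lsum_Rabs|].
          apply Rle_trans with (lsum (seq 1 m) (fun _ => / INR m * eps)).
          -- apply lsum_le. intros i Hi. apply in_seq in Hi. rewrite Rabs_mult.
             apply Rmult_le_compat; auto using Rabs_pos. apply HI; auto. lia.
          -- rewrite lsum_const, length_seq. right. field. lra.
        * transitivity (lsum (seq 1 m) (fun i => a i * w i t + - v t * a i)).
          -- apply lsum_ext. intros; ring.
          -- rewrite lsum_plus, lsum_scal. specialize (Hsum t Hs). lra.
      + rewrite lsum_const. apply Rle_trans with ((INR (length LL) + 1) * eps); [nra|].
        right. unfold eps. field. lra. }
  assert (H2 : Qval z2 Ps <= eta / 3).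
  { apply Rle_trans with (lsum (seq 1 m) (fun i =>
      Qval (vscale (a i) (restr (fun t => ~ low t /\ gap i t) (w i))) Ps)).
    - apply Qval_lsum_le. intros P t _ _. apply lsum_Rabs.
    - apply Rle_trans with (lsum (seq 1 m) (fun _ => / INR m * (eta / 3))).
      + apply lsum_le. intros i Hi. apply in_seq in Hi. rewrite Qval_scale.
        apply Rmult_le_compat; auto using Rabs_pos, Qval_nonneg.
        (* A tuple of the gap part has some entry in some gap, so this part is dominated by the sum
           of the restrictions over all pairs in [JL]. *)
        apply Rle_trans with (lsum JL (fun jl => Qval (restr (entry_in (snd jl)
          (q (pos m i (fst jl))) (gap_end k m q qe i (fst jl))) (w i)) Ps)).
        * apply Qval_lsum_le. intros P t _ _.
          destruct (classic (~ low t /\ gap i t)) as [Hg|Hg].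
          -- destruct Hg as [Hl [j [l [Hj [Hl' Hg]]]]].
             rewrite restr_in by (split; auto; exists j, l; auto).
             eapply Rle_trans; [|apply (lsum_term_le JL _ (j, l))].
             ++ simpl. rewrite restr_in by auto. lra.
             ++ intros; apply Rabs_pos.
             ++ apply in_prod; apply in_seq; lia.
          -- rewrite restr_out, Rabs_R0 by auto. apply lsum_nonneg.
             intros; apply Rabs_pos.
        * apply Rle_trans with (lsum JL (fun _ => delta)).
          -- apply lsum_le. intros [j l] Hjl. apply in_prod_iff in Hjl.
             destruct Hjl as [Hj Hl]. apply in_seq in Hj, Hl. cbn [fst snd].
             destruct (HI i ltac:(lia)) as [_ [HG1 HG2]]. unfold gap_end.
             destruct (Nat.ltb_spec j k) as [Hjk|Hjk].
             ++ apply (HG1 j Hjk l); auto; lia.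
             ++ replace j with k by lia. apply (HG2 qe l); auto; lia.
          -- rewrite lsum_const. unfold delta. right. field. lra.
      + rewrite lsum_const, length_seq. right. field. lra. }
  assert (H3 : Qval z3 Ps <= eta / 3).
  { apply Qval_le_iff; [lra|].
    apply Rle_trans with (INR (q0 + k) * C ^ 2 / INR m).
    - apply (main_part_norm m (q0 + k) C
        (fun i => restr (fun t => ~ low t /\ ~ gap i t) (w i)) a Ps); auto.
      + intros i. eapply Rle_trans; [apply Q2_mono; intros; apply restr_Rabs_le|].
        apply nle_Q2 with (S k); auto. apply HC.
      + intros P I HP HIn HI'. rewrite <- E0. apply main_count with (m := m) (P := P); auto.
        * apply admissible_iff in HPs. apply HPs; auto.
        * intros i Hi. destruct (HI' i Hi) as [Him [t [Ht Hw]]]. split; auto.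
          exists t. split; auto.
          pose proof (admissible_subsetN _ _ _ _ HPs HP Ht) as [Hs1 [Hs2 _]].
          assert (Hmain : ~ low t /\ ~ gap i t).
          { apply NNPP. intros Hn'. apply Hw. apply restr_out; auto. }
          destruct Hmain as [Hlow Hgap]. split.
          (* Entries increase, so a tuple that is not low has its last entry above [q 0]. *)
          -- apply Nat.nle_gt. intros Hle. apply Hlow. intros l Hl.
             pose proof (incrb_nth_le t l k Hs2 ltac:(lia)). lia.
          -- intros l Hl. destruct (Nat.le_gt_cases (nth l t 0%nat) (q 0%nat)) as [Hle|Hgt]; auto.
             right. apply find_block with qe.
             ++ split; auto. apply Hqe. apply in_concat. eauto.
             ++ intros j Hj Hg. apply Hgap. exists j, l. auto.
    - assert (INR m0 <= INR m) by (apply le_INR; auto).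
      assert (He3 : 0 < (eta / 3) ^ 2) by (apply pow_lt; lra).
      apply (Rmult_le_reg_r (INR m)); auto. unfold Rdiv at 1.
      rewrite Rmult_assoc, Rinv_l, Rmult_1_r by lra.
      apply Rmult_lt_compat_r with (r := (eta / 3) ^ 2) in Hm0; auto.
      unfold Rdiv at 1 in Hm0. rewrite Rmult_assoc, Rinv_l in Hm0 by lra. nra. }
  unfold w in HZ. lra.
Qed.

(** * The unconditional basis *)

Lemma e_same (s : list nat) : e s s = 1.
Proof. unfold e. destruct (list_eq_dec Nat.eq_dec s s); congruence. Qed.

Lemma e_other (s t : list nat) : t <> s -> e s t = 0.
Proof. intros H. unfold e. destruct (list_eq_dec Nat.eq_dec t s); congruence. Qed.

Lemma inX_e (d : nat) (s : list nat) : subsetN d s -> inX d (e s).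
Proof.
  intros Hs. apply inX_finite with [s].
  - intros t [<-|[]]; auto.
  - intros t Ht. apply e_other. intros ->. apply Ht. left; auto.
Qed.

Lemma nle_e (d : nat) (s : list nat) : nle d (e s) 1.
Proof.
  replace 1 with (fam_l1 (e s) [s]).
  - apply nle_finite. intros t _ Ht. apply e_other. intros ->. apply Ht. left; auto.
  - unfold fam_l1. simpl. rewrite e_same, Rabs_R1. ring.
Qed.

Lemma lsum_e (L : list (list nat)) (a : list nat -> R) (t : list nat) :
  NoDup L -> lsum L (fun s => a s * e s t) = if pb (In t L) then a t else 0.
Proof.
  intros HL. induction HL as [|s L Hs HL IH].
  - destruct (pb (In t [])) eqn:E; auto. apply (proj1 (pb_true _)) in E. destruct E.
  - rewrite lsum_cons, IH. destruct (list_eq_dec Nat.eq_dec t s) as [->|Ne].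
    + rewrite e_same. replace (pb (In s L)) with false by (symmetry; apply pb_false; auto).
      replace (pb (In s (s :: L))) with true by (symmetry; apply pb_true; left; auto). ring.
    + rewrite e_other by auto.
      replace (pb (In t (s :: L))) with (pb (In t L)); [ring|].
      destruct (pb (In t L)) eqn:E; symmetry.
      * apply pb_true. right. apply (proj1 (pb_true _)), E.
      * apply pb_false. apply (proj1 (pb_false _)) in E. intros [H|H]; congruence.
Qed.

Lemma finsum_restr (L : list (list nat)) (a : list nat -> R) (t : list nat) :
  NoDup L -> finsum L a t = restr (fun t => In t L) a t.
Proof. apply lsum_e. Qed.

(** Unconditional convergence is the smallness of tails off a finite set; coefficients are unique
    because coordinates are bounded by the norm. *)
Lemma uncond_basis_X (d : nat) : uncond_basis d.
Proof.
  assert (DEC := list_eq_dec Nat.eq_dec). split; [|split].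
  - apply inX_e.
  - intros x Hx eps He. pose proof (inX_bounded d x Hx) as HB.
    destruct (small_tail d x (eps / 2) HB ltac:(lra)) as [L HL].
    exists (nodup DEC (filter (fun t => pb (subsetN d t)) L)). split; [|split].
    + apply NoDup_nodup.
    + intros s Hs. apply nodup_In, filter_In in Hs. apply (proj1 (pb_true _)), Hs.
    + intros F HF HF' Hinc. apply Rle_lt_trans with (eps / 2); [|lra].
      apply Xnorm_le.
      apply nle_mono with (restr (fun t => ~ In t F /\ subsetN d t) x).
      * intros t Ht. unfold vsub. rewrite finsum_restr by auto.
        destruct (classic (In t F)).
        -- rewrite restr_in by auto. unfold Rminus. rewrite Rplus_opp_r, Rabs_R0.
           apply Rabs_pos.
        -- rewrite restr_out, restr_in, Rminus_0_r by auto. lra.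
      * apply HL. intros t [H1 H2] H3. apply H1, Hinc, nodup_In, filter_In.
        split; auto. apply pb_true; auto.
  - intros x a Hx Hu s Hs. apply cond_eq. intros eps He.
    destruct (Hu eps He) as [F0 [H1 [H2 H3]]].
    (* Adding [s] to the finite set makes [x s - a s] a coordinate of the remainder. *)
    specialize (H3 (nodup DEC (s :: F0)) (NoDup_nodup _ _)).
    assert (HS : forall s', In s' (nodup DEC (s :: F0)) -> subsetN d s').
    { intros s' Hs'. apply nodup_In in Hs'. destruct Hs' as [<-|Hs']; auto. }
    assert (HI : incl F0 (nodup DEC (s :: F0))).
    { intros s' Hs'. apply nodup_In. right; auto. }
    specialize (H3 HS HI). eapply Rle_lt_trans; [|apply H3].
    replace (Rabs (a s - x s)) with
      (Rabs (vsub x (finsum (nodup DEC (s :: F0)) a) s)).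
    + apply nle_coord with d; auto. apply nle_Xnorm.
      destruct (inX_bounded d x Hx) as [B HB].
      exists (B + Rabs (-1) * fam_l1 (finsum (nodup DEC (s :: F0)) a) (nodup DEC (s :: F0))).
      apply nle_mono with (vadd x (vscale (-1) (finsum (nodup DEC (s :: F0)) a))).
      * intros t _. right. f_equal. unfold vsub, vadd, vscale. ring.
      * apply nle_add; auto. apply nle_scale. apply nle_finite. intros t _ Ht.
        rewrite finsum_restr by apply NoDup_nodup. apply restr_out; auto.
    + unfold vsub. rewrite finsum_restr by apply NoDup_nodup.
      rewrite restr_in by (apply nodup_In; left; auto). apply Rabs_minus_sym.
Qed.

(** * The spreading model generated by the basis *)

Lemma sumR_stable (m M : nat) (f : nat -> R) :
  (forall j, (m < j)%nat -> f j = 0) -> (m <= M)%nat -> sumR M f = sumR m f.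
Proof.
  intros H HM. induction HM as [|M HM IH]; auto. simpl. rewrite IH, H by lia. ring.
Qed.

(** The length picked by [epsilon] is unknown, but any two admissible lengths give the same sum, as
    both can be enlarged to their maximum. *)
Lemma ell1_trunc (m : nat) (a : nat -> R) :
  ell1 (trunc m a) = sumR m (fun j => Rabs (a j)).
Proof.
  set (b := fun j => Rabs (trunc m a j)).
  assert (Hm : forall j, (m < j)%nat -> trunc m a j = 0).
  { intros j Hj. unfold trunc. destruct (Nat.leb_spec j m); [lia|].
    rewrite andb_false_r. auto. }
  assert (E : sumR m (fun j => Rabs (a j)) = sumR m b).
  { rewrite !sumR_lsum. apply lsum_ext. intros j Hj. apply in_seq in Hj. unfold b, trunc.
    destruct (Nat.leb_spec 1 j), (Nat.leb_spec j m); try lia. reflexivity. }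
  unfold ell1.
  destruct (epsilon_spec (inhabits 0) (fun r => exists m', (forall j, (m' < j)%nat ->
    trunc m a j = 0) /\ r = sumR m' (fun j => Rabs (trunc m a j)))) as [m' [H1 H2]].
  - exists (sumR m b), m. auto.
  - rewrite H2, E. fold b.
    rewrite <- (sumR_stable m' (Nat.max m m') b), <- (sumR_stable m (Nat.max m m') b);
      auto; try lia; intros j Hj; unfold b; rewrite ?H1, ?Hm by auto; apply Rabs_R0.
Qed.

Lemma plegma_nth_le (d m i j j' : nat) (M : nat -> nat) (s : nat -> list nat) :
  plegma d M m s -> (i < d)%nat -> (1 <= j)%nat -> (j <= j' <= m)%nat ->
  (nth i (s j) 0 <= nth i (s j') 0)%nat.
Proof.
  intros [_ [H _]] Hi Hj [H1 H2]. induction H1 as [|j' H1 IH]; auto.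
  specialize (IH ltac:(lia)). specialize (H j' i ltac:(lia) Hi). lia.
Qed.

Lemma plegma_nth_inj (d m i j j' : nat) (M : nat -> nat) (s : nat -> list nat) :
  plegma d M m s -> (i < d)%nat -> (1 <= j <= m)%nat -> (1 <= j' <= m)%nat ->
  nth i (s j) 0%nat = nth i (s j') 0%nat -> j = j'.
Proof.
  intros HP Hi Hj Hj' E. pose proof HP as [_ [H _]].
  destruct (Nat.lt_trichotomy j j') as [Hl|[->|Hl]]; auto; exfalso.
  - pose proof (H j i ltac:(lia) Hi).
    pose proof (plegma_nth_le d m i (S j) j' M s HP Hi ltac:(lia) ltac:(lia)). lia.
  - pose proof (H j' i ltac:(lia) Hi).
    pose proof (plegma_nth_le d m i (S j') j M s HP Hi ltac:(lia) ltac:(lia)). lia.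
Qed.

Lemma nth_map_seq {T : Type} (f : nat -> T) (n i : nat) (d : T) :
  (i < n)%nat -> nth i (map f (seq 0 n)) d = f i.
Proof.
  intros Hi. rewrite (nth_indep _ _ (f 0%nat)) by (rewrite length_map, length_seq; auto).
  rewrite map_nth, seq_nth by auto. reflexivity.
Qed.

(** [F_i] collects the [i]-th entries of the members. It has [m] elements, and those of [F_1] are at
    least [s_1(1) >= m]. *)
Lemma plegma_schreier (k m : nat) (M : nat -> nat) (s : nat -> list nat) :
  plegma (S k) M m s -> (m <= nth 0 (s 1%nat) 0)%nat ->
  schreier_plegmatic (S k) (map s (seq 1 m)).
Proof.
  intros HP Hm. pose proof HP as [H1 [H2 H3]].
  set (F := map (fun i => map (fun j => nth i (s j) 0%nat) (seq 1 m)) (seq 0 (S k))).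
  assert (HF : forall i, (i < S k)%nat ->
    nth i F [] = map (fun j => nth i (s j) 0%nat) (seq 1 m)).
  { intros i Hi. apply (nth_map_seq (fun i => map (fun j => nth i (s j) 0%nat) (seq 1 m))).
    auto. }
  exists F. split; [split; [|split; [|split; [|split]]]|].
  - intros t Ht. apply in_map_iff in Ht. destruct Ht as [j [<- Hj]]. apply in_seq in Hj.
    apply H1. lia.
  - unfold F. rewrite length_map, length_seq. auto.
  - intros i Hi. rewrite !HF by lia. rewrite !length_map. split; auto.
    apply NoDup_map_NoDup_ForallPairs; [|apply seq_NoDup].
    intros j j' Hj Hj' E. apply in_seq in Hj, Hj'.
    apply plegma_nth_inj with (1 := HP) (i := i); auto; lia.
  - intros i a b Hi. rewrite !HF by lia. intros Ha Hb. apply in_map_iff in Ha, Hb.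
    destruct Ha as [j [<- Hj]], Hb as [j' [<- Hj']]. apply in_seq in Hj, Hj'.
    pose proof (plegma_nth_le _ m i j m M s HP ltac:(lia) ltac:(lia) ltac:(lia)).
    pose proof (plegma_nth_le _ m (i + 1) 1 j' M s HP ltac:(lia) ltac:(lia) ltac:(lia)).
    specialize (H3 i Hi). lia.
  - intros t Ht i Hi. rewrite HF by auto. apply in_map_iff in Ht.
    destruct Ht as [j [<- Hj]]. apply (in_map (fun j => nth i (s j) 0%nat)). auto.
  - intros a. rewrite HF by lia. rewrite length_map, length_seq. intros Ha.
    apply in_map_iff in Ha. destruct Ha as [j [<- Hj]]. apply in_seq in Hj.
    pose proof (plegma_nth_le _ m 0 1 j M s HP ltac:(lia) ltac:(lia) ltac:(lia)). lia.
Qed.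

(** Upper bound by the triangle inequality; lower bound by taking the members themselves as one
    Schreier plegmatic family. *)
Lemma plegma_norm (k m : nat) (M : nat -> nat) (s : nat -> list nat) (a : nat -> R) :
  plegma (S k) M m s -> (m <= nth 0 (s 1%nat) 0)%nat ->
  Xnorm (S k) (fun t => sumR m (fun j => a j * e (s j) t)) = sumR m (fun j => Rabs (a j)).
Proof.
  intros HP Hm. set (z := fun t => sumR m (fun j => a j * e (s j) t)).
  assert (Hinj : forall j j', (1 <= j <= m)%nat -> (1 <= j' <= m)%nat ->
    s j = s j' -> j = j').
  { intros j j' Hj Hj' E. apply plegma_nth_inj with (1 := HP) (i := 0%nat); auto; try lia.
    rewrite E. auto. }
  assert (HU : nle (S k) z (sumR m (fun j => Rabs (a j)))).
  { intros Ps HPs. rewrite sumR_lsum.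
    apply Rle_trans with (lsum (seq 1 m) (fun j => Qval (vscale (a j) (e (s j))) Ps)).
    - apply Qval_lsum_le. intros P t _ _. unfold z. rewrite sumR_lsum. apply lsum_Rabs.
    - apply lsum_le. intros j _. rewrite Qval_scale.
      rewrite <- (Rmult_1_r (Rabs (a j))) at 2.
      apply Rmult_le_compat_l; [apply Rabs_pos|]. apply (nle_e (S k)); auto. }
  apply Rle_antisym; [apply Xnorm_le; auto|].
  eapply Rle_trans; [|apply (nle_Xnorm (S k) z (ex_intro _ _ HU) [map s (seq 1 m)])].
  - rewrite Qval_sqrt. unfold Q2. rewrite lsum_cons. unfold lsum at 1. cbn [fold_right].
    rewrite Rplus_0_r, sqrt_pow2 by apply fam_l1_nonneg.
    rewrite fam_l1_lsum, lsum_map, sumR_lsum. apply lsum_le. intros j Hj.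
    apply in_seq in Hj. right. f_equal. unfold z. rewrite sumR_lsum.
    destruct (in_split j (seq 1 m)) as [l1 [l2 El]]; [apply in_seq; lia|].
    assert (HN : NoDup (l1 ++ j :: l2)) by (rewrite <- El; apply seq_NoDup).
    assert (Hz : forall l, (forall j', In j' l -> In j' (seq 1 m) /\ j' <> j) ->
      lsum l (fun j0 => a j0 * e (s j0) (s j)) = 0).
    { intros l Hl. apply lsum_zero. intros j' Hj'. destruct (Hl j' Hj') as [Hs Hne].
      apply in_seq in Hs. rewrite e_other; [ring|]. intros E. apply Hne.
      symmetry. apply Hinj; auto; lia. }
    apply NoDup_remove in HN. destruct HN as [_ HN].
    rewrite El, lsum_app, lsum_cons, e_same, !Hz; [ring| |];
      intros j' Hj'; split; try (rewrite El; apply in_or_app; simpl; auto);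
      intros ->; apply HN; apply in_or_app; auto.
  - apply admissible_single; [|apply plegma_schreier with M; auto].
    apply NoDup_map_NoDup_ForallPairs; [|apply seq_NoDup].
    intros j j' Hj Hj' E. apply in_seq in Hj, Hj'. apply Hinj; auto; lia.
Qed.

Lemma generates_ell1 (k : nat) :
  exists Mseq, infinite_seq Mseq /\ generates (S k) (Xnorm (S k)) e ell1 Mseq.
Proof.
  (* Here [M(l) = l], so [s_1(1) >= l >= m] and the norm is exactly the l1-norm; the error [1/(l+1)]
     only has to be positive and null. *)
  exists S. split; [split; [lia|intros; lia]|].
  exists (fun l => / INR (S l)). split; [|split].
  - intros l. apply Rinv_0_lt_compat, lt_0_INR. lia.
  - intros eps He. destruct (archimed_cor1 eps He) as [N [HN HN0]]. exists N. intros n Hn.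
    unfold R_dist. rewrite Rminus_0_r, Rabs_pos_eq.
    + eapply Rle_lt_trans; [|apply HN]. apply Rinv_le_contravar; [apply lt_0_INR; auto|].
      apply le_INR. lia.
    + apply Rlt_le, Rinv_0_lt_compat, lt_0_INR. lia.
  - intros l m s a Hm HP Hl Ha. rewrite plegma_norm with (M := S) by (auto; lia).
    rewrite ell1_trunc. unfold Rminus. rewrite Rplus_opp_r, Rabs_R0.
    apply Rlt_le, Rinv_0_lt_compat, lt_0_INR. lia.
Qed.

(** * Failure of Cesaro summability *)

Lemma in_prodl_nth (Fs : list (list nat)) (t : list nat) :
  In t (prodl Fs) ->
  length t = length Fs /\
  forall i, (i < length Fs)%nat -> In (nth i t 0%nat) (nth i Fs []).
Proof.
  rewrite in_prodl. intros H. induction H as [|a F t Fs Ha H [IH1 IH2]]; simpl.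
  - split; auto. lia.
  - split; [lia|]. intros [|i] Hi; auto. apply IH2. lia.
Qed.

Lemma NoDup_prodl (Fs : list (list nat)) :
  (forall F, In F Fs -> NoDup F) -> NoDup (prodl Fs).
Proof.
  induction Fs as [|F Fs IH]; intros H; simpl; [repeat constructor; simpl; tauto|].
  assert (HN : NoDup (prodl Fs)) by (apply IH; intros; apply H; simpl; auto).
  specialize (H F (or_introl eq_refl)). clear IH. induction H as [|a F Ha HF IH]; simpl.
  - constructor.
  - apply NoDup_app_iff. split; [|split; auto].
    + apply NoDup_map_NoDup_ForallPairs; auto. intros t t' _ _ E. congruence.
    + intros t Ht Ht'. apply in_map_iff in Ht. destruct Ht as [t1 [<- _]].
      apply in_flat_map in Ht'. destruct Ht' as [b [Hb Ht']]. apply in_map_iff in Ht'.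
      destruct Ht' as [t2 [E _]]. injection E as -> _. contradiction.
Qed.

Lemma length_prodl (Fs : list (list nat)) (r : nat) :
  (forall F, In F Fs -> length F = r) -> length (prodl Fs) = (r ^ length Fs)%nat.
Proof.
  induction Fs as [|F Fs IH]; intros H; simpl; auto.
  rewrite <- IH by (intros; apply H; simpl; auto).
  rewrite <- (H F (or_introl eq_refl)). clear H IH.
  induction F as [|a F IH]; simpl; auto. rewrite length_app, length_map, IH. auto.
Qed.

Lemma incrb_of_nth (s : list nat) :
  (forall i, (i + 1 < length s)%nat -> (nth i s 0 < nth (i + 1) s 0)%nat) ->
  incrb s = true.
Proof.
  induction s as [|a [|b s] IH]; auto. intros H. cbn [incrb].
  rewrite andb_true_iff, Nat.ltb_lt. split.
  - apply (H 0%nat). simpl. lia.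
  - apply IH. intros i Hi. apply (H (S i)). simpl in *. lia.
Qed.

Lemma infinite_seq_lt (M : nat -> nat) (a b : nat) :
  infinite_seq M -> (a < b)%nat -> (M a < M b)%nat.
Proof. intros [_ H] Hab. apply increasing_lt with b; auto. Qed.

Lemma infinite_seq_ge (M : nat -> nat) (a : nat) : infinite_seq M -> (S a <= M a)%nat.
Proof.
  intros [H0 H]. induction a as [|a IH]; auto. specialize (H a). lia.
Qed.

Lemma fact_le_pow (n d : nat) : (d <= n)%nat -> (fact n <= n ^ d * fact (n - d))%nat.
Proof.
  induction d as [|d IH]; intros Hd.
  - rewrite Nat.sub_0_r. simpl. lia.
  - specialize (IH ltac:(lia)).
    replace (n - d)%nat with (S (n - S d)) in IH by lia.
    rewrite fact_simpl in IH. rewrite Nat.pow_succ_r'.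
    assert (S (n - S d) <= n)%nat by lia.
    assert (n ^ d * (S (n - S d) * fact (n - S d)) <= n * n ^ d * fact (n - S d))%nat by nia.
    lia.
Qed.

Lemma binomial_le_pow (n d : nat) : (d <= n)%nat -> 0 < Binomial.C n d <= INR n ^ d.
Proof.
  intros Hd. unfold Binomial.C.
  assert (H1 : 0 < INR (fact n)) by apply INR_fact_lt_0.
  assert (H2 : 0 < INR (fact (n - d))) by apply INR_fact_lt_0.
  assert (H3 : 1 <= INR (fact d)).
  { change 1 with (INR 1). apply le_INR. pose proof (lt_O_fact d). lia. }
  assert (H4 : INR (fact n) <= INR n ^ d * INR (fact (n - d))).
  { rewrite <- pow_INR, <- mult_INR. apply le_INR, fact_le_pow; auto. }
  assert (H5 : 0 < INR (fact d) * INR (fact (n - d))) by nra.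
  split; [apply Rdiv_lt_0_compat; auto|].
  apply Rmult_le_reg_r with (1 := H5). unfold Rdiv.
  rewrite Rmult_assoc, Rinv_l, Rmult_1_r by lra.
  assert (0 <= INR n ^ d) by (apply pow_le, pos_INR).
  eapply Rle_trans; [apply H4|]. apply Rmult_le_compat_l; auto. nra.
Qed.

(** Blocks of [r] consecutive terms, the first [r] terms being skipped: this makes every element of
    the first block exceed [r], as the Schreier condition requires. All blocks lie among the first
    [(d + 1) r] terms. *)
Definition cesaro_blocks (d : nat) (M : nat -> nat) (r : nat) : list (list nat) :=
  map (fun i => map M (seq ((i + 1) * r) r)) (seq 0 d).

Lemma cesaro_blocks_spec (d r : nat) (M : nat -> nat) (t : list nat) :
  infinite_seq M -> In t (prodl (cesaro_blocks d M r)) ->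
  length t = d /\
  forall i, (i < d)%nat -> exists c, ((i + 1) * r <= c < (i + 2) * r)%nat /\
    nth i t 0%nat = M c.
Proof.
  intros HM Ht. apply in_prodl_nth in Ht. unfold cesaro_blocks in Ht.
  rewrite length_map, length_seq in Ht. destruct Ht as [H1 H2]. split; auto.
  intros i Hi. specialize (H2 i Hi).
  rewrite (nth_map_seq (fun i => map M (seq ((i + 1) * r) r))) in H2 by auto.
  apply in_map_iff in H2. destruct H2 as [c [E Hc]]. apply in_seq in Hc. exists c.
  split; auto. lia.
Qed.

Lemma cesaro_blocks_subsetN (d r : nat) (M : nat -> nat) (t : list nat) :
  infinite_seq M -> In t (prodl (cesaro_blocks d M r)) -> subsetN d t.
Proof.
  intros HM Ht. destruct (cesaro_blocks_spec d r M t HM Ht) as [H1 H2].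
  split; [auto|split].
  - apply incrb_of_nth. intros i Hi.
    destruct (H2 i ltac:(lia)) as [c [Hc ->]].
    destruct (H2 (i + 1)%nat ltac:(lia)) as [c' [Hc' ->]].
    apply infinite_seq_lt; auto. lia.
  - apply Forall_forall. intros a Ha. apply (In_nth _ _ 0%nat) in Ha.
    destruct Ha as [i [Hi <-]]. destruct (H2 i ltac:(lia)) as [c [_ ->]].
    pose proof (infinite_seq_ge M c HM). lia.
Qed.

Lemma cesaro_blocks_schreier (k r : nat) (M : nat -> nat) :
  infinite_seq M -> schreier_plegmatic (S k) (prodl (cesaro_blocks (S k) M r)).
Proof.
  intros HM. set (d := S k).
  assert (HF : forall i, (i < d)%nat ->
    nth i (cesaro_blocks d M r) [] = map M (seq ((i + 1) * r) r)).
  { intros i Hi. apply (nth_map_seq (fun i => map M (seq ((i + 1) * r) r))). auto. }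
  exists (cesaro_blocks d M r). split; [split; [|split; [|split; [|split]]]|].
  - intros s. apply cesaro_blocks_subsetN; auto.
  - unfold cesaro_blocks. rewrite length_map, length_seq. auto.
  - intros i Hi. rewrite !HF by (unfold d in *; lia).
    rewrite !length_map, !length_seq. split; auto.
    apply NoDup_map_NoDup_ForallPairs; [|apply seq_NoDup]. intros c c' _ _ E.
    destruct (Nat.lt_trichotomy c c') as [Hl|[->|Hl]]; auto;
      apply (infinite_seq_lt M _ _ HM) in Hl; lia.
  - intros i a b Hi. rewrite !HF by lia. intros Ha Hb. apply in_map_iff in Ha, Hb.
    destruct Ha as [c [<- Hc]], Hb as [c' [<- Hc']]. apply in_seq in Hc, Hc'.
    apply infinite_seq_lt; auto. lia.
  - intros s Hs i Hi. apply in_prodl_nth in Hs. apply Hs. unfold cesaro_blocks.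
    rewrite length_map, length_seq. auto.
  - intros a. rewrite HF by (unfold d; lia). rewrite length_map, length_seq. intros Ha.
    apply in_map_iff in Ha. destruct Ha as [c [<- Hc]]. apply in_seq in Hc.
    pose proof (infinite_seq_ge M c HM). lia.
Qed.

Lemma cesaro_blocks_in_Mn (d r : nat) (M : nat -> nat) (t : list nat) :
  infinite_seq M -> In t (prodl (cesaro_blocks d M r)) ->
  in_Mn_b d M ((d + 1) * r) t = true.
Proof.
  intros HM Ht. destruct (cesaro_blocks_spec d r M t HM Ht) as [H1 H2].
  destruct (cesaro_blocks_subsetN d r M t HM Ht) as [_ [H3 _]].
  unfold in_Mn_b. rewrite !andb_true_iff. repeat split; auto.
  - apply Nat.eqb_eq; auto.
  - apply forallb_forall. intros a Ha. apply existsb_exists. exists a.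
    split; [|apply Nat.eqb_refl]. apply (In_nth _ _ 0%nat) in Ha.
    destruct Ha as [i [Hi <-]]. destruct (H2 i ltac:(lia)) as [c [Hc ->]].
    apply in_map, in_seq. nia.
Qed.

Lemma nle_cesaro_avg (d n : nat) (M : nat -> nat) : exists B, nle d (cesaro_avg d M n) B.
Proof.
  set (L := prodl (repeat (map M (seq 0 n)) d)). exists (fam_l1 (cesaro_avg d M n) L).
  apply nle_finite. intros t _ Ht. unfold cesaro_avg.
  destruct (in_Mn_b d M n t) eqn:E; auto. exfalso. apply Ht. unfold L. apply in_prodl.
  unfold in_Mn_b in E. rewrite !andb_true_iff in E. destruct E as [[E1 _] E2].
  apply Nat.eqb_eq in E1. rewrite <- E1. clear E1 Ht L.
  induction t as [|a t IH]; cbn [length repeat]; constructor.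
  - simpl in E2. apply andb_true_iff in E2. destruct E2 as [E2 _].
    apply existsb_exists in E2. destruct E2 as [b [Hb E]]. apply Nat.eqb_eq in E.
    subst; auto.
  - apply IH. simpl in E2. apply andb_true_iff in E2. tauto.
Qed.

(** The product of the blocks has [r^d] tuples, each of weight at least [((d + 1) r)^(-d)], so the
    average has mass at least [c = (d + 1)^(-d)] there. For large [r] the vector [x0] has mass at
    most [c / 2] there, which leaves a distance of at least [c / 2]. *)
Lemma not_cesaro_summable (k : nat) (M : nat -> nat) (x0 : vec) :
  infinite_seq M -> inX (S k) x0 -> ~ cesaro_summable (S k) M x0.
Proof.
  intros HM Hx Hc. set (d := S k) in *.
  set (c := / INR (d + 1) ^ d).
  assert (Hd1 : 0 < INR (d + 1)) by (apply lt_0_INR; lia).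
  assert (Hcpos : 0 < c) by (apply Rinv_0_lt_compat, pow_lt; auto).
  destruct (small_tail d x0 (c / 2) (inX_bounded d x0 Hx) ltac:(lra)) as [L HL].
  destruct (entries_bounded L) as [b Hb].
  destruct (Hc (c / 4) ltac:(lra)) as [N HN].
  (* Large enough that first entries in the blocks exceed all entries in [L], and that [n >= N]. *)
  set (r := (S (Nat.max b N))). set (n := ((d + 1) * r)%nat).
  assert (Hn : (n >= N)%nat) by (unfold n, r; nia).
  specialize (HN n Hn). unfold R_dist in HN. rewrite Rminus_0_r in HN.
  set (P := prodl (cesaro_blocks d M r)).
  set (y := vsub (cesaro_avg d M n) x0) in *.
  assert (HB : exists B, nle d y B).
  { destruct (nle_cesaro_avg d n M) as [B1 HB1].
    destruct (inX_bounded d x0 Hx) as [B2 HB2]. exists (B1 + Rabs (-1) * B2).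
    apply nle_mono with (vadd (cesaro_avg d M n) (vscale (-1) x0)).
    - intros t _. right. f_equal. unfold y, vsub, vadd, vscale. ring.
    - apply nle_add; auto. apply nle_scale; auto. }
  rewrite Rabs_pos_eq in HN by (apply Xnorm_nonneg; auto).
  assert (HPa : admissible d [P]).
  { apply admissible_single; [|apply cesaro_blocks_schreier; auto].
    apply NoDup_prodl. intros F HF. apply in_map_iff in HF. destruct HF as [i [<- _]].
    apply NoDup_map_NoDup_ForallPairs; [|apply seq_NoDup]. intros a a' _ _ E.
    destruct (Nat.lt_trichotomy a a') as [Hl|[->|Hl]]; auto;
      apply (infinite_seq_lt M _ _ HM) in Hl; lia. }
  assert (Q1 : forall w, Qval w [P] = fam_l1 w P).
  { intros w. rewrite Qval_sqrt. unfold Q2. rewrite lsum_cons. unfold lsum.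
    cbn [fold_right]. rewrite Rplus_0_r, sqrt_pow2 by apply fam_l1_nonneg. auto. }
  assert (HY : fam_l1 y P <= Xnorm d y) by (rewrite <- Q1; apply nle_Xnorm; auto).
  assert (HX : fam_l1 x0 P <= c / 2).
  { apply Rle_trans with (fam_l1 (restr (fun t => In t P) x0) P).
    - apply fam_l1_le. intros t Ht. rewrite restr_in by auto. lra.
    - rewrite <- Q1. apply HL; auto. intros t Ht Ht'.
      destruct (cesaro_blocks_spec d r M t HM Ht) as [_ H2].
      destruct (H2 0%nat ltac:(unfold d; lia)) as [a [Ha E]].
      specialize (Hb t 0%nat Ht'). rewrite E in Hb.
      pose proof (infinite_seq_ge M a HM). unfold r in Ha. lia. }
  destruct (binomial_le_pow n d ltac:(unfold n, r; nia)) as [HC1 HC2].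
  assert (HA : c <= fam_l1 (cesaro_avg d M n) P).
  { rewrite fam_l1_lsum. apply Rle_trans with (lsum P (fun _ => / Binomial.C n d)).
    - rewrite lsum_const. unfold P.
      rewrite length_prodl with (r := r).
      + unfold cesaro_blocks. rewrite length_map, length_seq, pow_INR.
        assert (Hr : 0 < INR r) by (apply lt_0_INR; unfold r; lia).
        apply Rmult_le_reg_r with (1 := HC1). rewrite Rmult_assoc, Rinv_l, Rmult_1_r by lra.
        apply Rle_trans with (c * INR n ^ d); [apply Rmult_le_compat_l; lra|].
        right. unfold n, c. rewrite mult_INR, Rpow_mult_distr. field.
        apply pow_nonzero. lra.
      + intros F HF. apply in_map_iff in HF. destruct HF as [i [<- _]].
        rewrite length_map, length_seq. auto.
    - apply lsum_le. intros t Ht. unfold cesaro_avg, n.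
      rewrite (cesaro_blocks_in_Mn d r M t HM Ht). apply Rle_abs. }
  assert (HT : fam_l1 (cesaro_avg d M n) P <= fam_l1 y P + fam_l1 x0 P).
  { rewrite !fam_l1_lsum, <- lsum_plus. apply lsum_le. intros t _.
    replace (cesaro_avg d M n t) with (y t + x0 t) by (unfold y, vsub; ring).
    apply Rabs_triang. }
  lra.
Qed.

(** * Spreading models of order k *)

Lemma Rabs_le_inv (a b : R) : Rabs a <= b -> - b <= a <= b.
Proof.
  intros H. pose proof (Rle_abs a). pose proof (Rle_abs (- a)) as H'.
  rewrite Rabs_Ropp in H'. lra.
Qed.

Lemma member_length (n : nat -> nat) (k m i : nat) : length (member n k m i) = k.
Proof. unfold member. rewrite length_map, length_seq. auto. Qed.

Lemma member_nth (n : nat -> nat) (k m i j : nat) :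
  (j < k)%nat -> nth j (member n k m i) 0%nat = n (j * m + i)%nat.
Proof. intros Hj. apply (nth_map_seq (fun j => n (j * m + i)%nat)). auto. Qed.

Lemma member_incrb (n : nat -> nat) (k m i : nat) :
  (forall a, (a < k * m)%nat -> (n a < n (S a))%nat) -> (1 <= i <= m)%nat ->
  incrb (member n k m i) = true.
Proof.
  intros Hn Hi. apply incrb_of_nth. rewrite member_length. intros j Hj.
  rewrite !member_nth by lia. apply increasing_lt with (k * m)%nat; auto. nia.
Qed.

Lemma subsetN_map (k : nat) (M : nat -> nat) (s : list nat) :
  infinite_seq M -> length s = k -> incrb s = true -> subsetN k (map M s).
Proof.
  intros HM Hl Hs. split; [rewrite length_map; auto|split].
  - apply incrb_of_nth. rewrite length_map. intros i Hi.
    rewrite !(nth_indep (map M s) 0%nat (M 0%nat)) by (rewrite length_map; lia).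
    rewrite !map_nth. apply infinite_seq_lt; auto. apply incrb_nth_S; auto.
  - apply Forall_forall. intros a Ha. apply in_map_iff in Ha. destruct Ha as [b [<- _]].
    pose proof (infinite_seq_ge M b HM). lia.
Qed.

Lemma map_member_nth (M n : nat -> nat) (k m i j : nat) :
  (j < k)%nat -> nth j (map M (member n k m i)) 0%nat = M (n (j * m + i)%nat).
Proof.
  intros Hj. unfold member. rewrite map_map.
  apply (nth_map_seq (fun j => M (n (j * m + i)%nat))). auto.
Qed.

Lemma plegma_member (k m : nat) (M n : nat -> nat) :
  infinite_seq M -> (forall a, (a < k * m)%nat -> (n a < n (S a))%nat) -> (1 <= m)%nat ->
  plegma k M m (fun i => map M (member n k m i)).
Proof.
  intros HM Hn Hm. split; [|split].
  - intros j Hj. split.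
    + apply subsetN_map; auto using member_length. apply member_incrb; auto.
    + intros a Ha. apply in_map_iff in Ha. destruct Ha as [l [<- _]]. eauto.
  - intros j i Hj Hi. rewrite !map_member_nth by auto. apply infinite_seq_lt; auto.
    apply increasing_lt with (k * m)%nat; auto. nia.
  - intros i Hi. rewrite !map_member_nth by lia. apply infinite_seq_lt; auto.
    apply increasing_lt with (k * m)%nat; auto. nia.
Qed.

(** Absolute values over [1, ..., m] sum to 1, and for even [m] the sum is zero, which cancels any
    coordinatewise limit. *)
Definition alternating (m i : nat) : R := if Nat.even i then / INR m else - / INR m.

Lemma alternating_sum (m p : nat) : lsum (seq 1 (2 * p)) (alternating m) = 0.
Proof.
  induction p as [|p IH]; [reflexivity|].
  replace (2 * S p)%nat with (S (S (2 * p))) by lia.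
  rewrite !seq_S, !lsum_app, IH. unfold lsum, alternating. cbn [fold_right].
  replace (1 + S (2 * p))%nat with (S (S (2 * p))) by lia.
  replace (1 + 2 * p)%nat with (S (2 * p)) by lia.
  rewrite Nat.even_succ_succ, Nat.even_succ, Nat.even_even, <- Nat.negb_even,
    Nat.even_even. simpl. ring.
Qed.

Lemma alternating_Rabs (m i : nat) : (1 <= m)%nat -> Rabs (alternating m i) = / INR m.
Proof.
  intros Hm. assert (0 < / INR m) by (apply Rinv_0_lt_compat, lt_0_INR; lia).
  unfold alternating. destruct (Nat.even i); rewrite ?Rabs_Ropp; apply Rabs_pos_eq; lra.
Qed.

(** On alternating coefficients an l1 lower estimate gives a seminorm of at least [c], while the
    vectors have norm at most [c / 4] and the error [delta l] is below [c / 4]. *)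
Lemma SM_not_l1 (k : nat) (x : list nat -> vec) (snorm : (nat -> R) -> R) :
  (1 <= k)%nat -> in_SM k (S k) x snorm -> ~ equiv_l1 snorm.
Proof.
  intros hk [Hx [_ [M [HM [delta [Hd0 [Hd1 HG]]]]]]] [c [C [Hc [HC HE]]]].
  destruct free_ultrafilter_nat as [U [HU HF]].
  (* Indexed by positions in [M], and zero on other lists, so that one bound holds for all lists. *)
  set (xs := fun s => if pb (length s = k /\ incrb s = true) then x (map M s)
                      else (fun _ => 0) : vec).
  assert (Exs : forall s, length s = k -> incrb s = true -> xs s = x (map M s)).
  { intros s H1 H2. unfold xs.
    replace (pb (length s = k /\ incrb s = true)) with true; auto.
    symmetry. apply pb_true; auto. }
  (* A single tuple is a plegma family with [m = l = 1]; its vector has norm at most the seminorm of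
     [e_1], hence at most [C], plus [delta 1]. *)
  set (B := C + delta 1%nat).
  assert (HB : forall s, nle (S k) (xs s) B).
  { intros s. destruct (classic (length s = k /\ incrb s = true)) as [[H1 H2]|Hs].
    - rewrite Exs by auto. pose proof (subsetN_map k M s HM H1 H2) as Hsub.
      apply nle_weaken with (Xnorm (S k) (x (map M s))); [|apply inX_nle; auto].
      specialize (HG 1%nat 1%nat (fun _ => map M s) (fun _ => 1) ltac:(lia)).
      assert (HP : plegma k M 1 (fun _ => map M s)).
      { split; [|split].
        - intros j _. split; auto. intros a Ha. apply in_map_iff in Ha.
          destruct Ha as [l [<- _]]. eauto.
        - intros; lia.
        - intros i Hi. apply incrb_nth_S; [apply Hsub|]. rewrite length_map. lia. }
      assert (HM0 : (M (1 - 1) <= nth 0 (map M s) 0)%nat).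
      { destruct s as [|a s]; [simpl in H1; lia|]. simpl.
        destruct a; auto. apply Nat.lt_le_incl, infinite_seq_lt; auto. lia. }
      specialize (HG HP HM0 ltac:(intros; lra)). cbv beta in HG.
      replace (fun t => sumR 1 (fun _ => 1 * x (map M s) t)) with (x (map M s)) in HG
        by (apply functional_extensionality; intros t; simpl; ring).
      destruct (HE 1%nat (fun _ => 1)) as [_ HE1]. simpl sumR in HE1.
      rewrite Rabs_R1 in HE1. apply Rabs_le_inv in HG.
      unfold B. lra.
    - unfold xs. replace (pb (length s = k /\ incrb s = true)) with false
        by (symmetry; apply pb_false; auto).
      intros Ps _. rewrite Qval_zero. unfold B. specialize (Hd0 1%nat). lra. }
  assert (Hv : forall t, exists v, subsetN (S k) t -> forall eps, 0 < eps ->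
    Uq U k (fun s => Rabs (xs s t - v) <= eps)).
  { intros t. destruct (classic (subsetN (S k) t)) as [Ht|Ht].
    - destruct (ultra_limit (Uq U k) (fun s => xs s t) B) as [v Hv].
      + apply ultra_Uq; auto.
      + intros s. apply nle_coord with (S k); auto.
      + exists v. auto.
    - exists 0. tauto. }
  apply choice in Hv. destruct Hv as [v Hv].
  destruct (small_plegma_averages k U xs B v (c / 4) HU HF HB
    (fun t eps Ht He => Hv t Ht eps He) ltac:(lra)) as [m0 Hm0].
  (* Even, for the alternating sum to vanish. *)
  set (m := (2 * S m0)%nat).
  destruct (Hd1 (c / 4) ltac:(lra)) as [N HN].
  set (l := Nat.max m N).
  destruct (Hm0 m l ltac:(unfold m; lia) ltac:(unfold m; lia)) as [n [Hn1 [Hn2 Hn3]]].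
  assert (Hm1 : (1 <= m)%nat) by (unfold m; lia).
  assert (Hmp : 0 < INR m) by (apply lt_0_INR; lia).
  specialize (Hn3 (alternating m)).
  assert (HZ : nle (S k) (fun t => sumR m (fun j =>
    alternating m j * x (map M (member n k m j)) t)) (c / 4)).
  { eapply nle_mono; [|apply Hn3].
    - intros t _. right. f_equal. rewrite sumR_lsum. apply lsum_ext. intros j Hj.
      apply in_seq in Hj. rewrite Exs; auto using member_length.
      apply member_incrb; auto. lia.
    - intros i. rewrite alternating_Rabs by auto. lra.
    - intros t _. unfold m at 1. rewrite alternating_sum. ring. }
  specialize (HG l m (fun i => map M (member n k m i)) (alternating m)
    ltac:(unfold l; lia) (plegma_member k m M n HM Hn1 Hm1)).
  assert (HM1 : (M (l - 1) <= nth 0 (map M (member n k m 1)) 0)%nat).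
  { rewrite map_member_nth by lia. specialize (Hn2 (0 * m + 1)%nat).
    apply Nat.lt_le_incl, infinite_seq_lt; auto. unfold l in *. lia. }
  assert (HA1 : forall j, (1 <= j <= m)%nat -> -1 <= alternating m j <= 1).
  { intros j _. apply Rabs_le_inv. rewrite alternating_Rabs by auto.
    rewrite <- Rinv_1. apply Rinv_le_contravar; [lra|]. apply (le_INR 1); auto. }
  specialize (HG HM1 HA1). destruct (HE m (alternating m)) as [HE1 _].
  rewrite sumR_lsum, (lsum_ext _ _ (fun _ => / INR m)), lsum_const, length_seq,
    Rinv_r, Rmult_1_r in HE1; [|lra|intros; apply alternating_Rabs; auto].
  specialize (HN l ltac:(unfold l; lia)). unfold R_dist in HN.
  rewrite Rminus_0_r, Rabs_pos_eq in HN by (apply Rlt_le; auto).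
  apply Xnorm_le in HZ. apply Rabs_le_inv in HG. lra.
Qed.

(** * Reflexivity *)

Definition sgn (r : R) : R := if Rle_dec 0 r then 1 else -1.

Lemma sgn_mult (r : R) : sgn r * r = Rabs r.
Proof.
  unfold sgn. destruct (Rle_dec 0 r).
  - rewrite Rabs_pos_eq by auto. ring.
  - rewrite Rabs_left by lra. ring.
Qed.

Lemma sgn_Rabs (r : R) : Rabs (sgn r) = 1.
Proof. unfold sgn. destruct (Rle_dec 0 r); [apply Rabs_R1|rewrite Rabs_left; lra]. Qed.

Lemma functional_Rabs_le (d : nat) (f : vec -> R) (D : R) :
  bdd_lin_functional d f D ->
  forall x, inX d x -> Rabs (f x) <= Rabs D * Xnorm d x.
Proof.
  intros [_ [_ H]] x Hx. eapply Rle_trans; [apply H; auto|].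
  apply Rmult_le_compat_r; [|apply Rle_abs]. apply Xnorm_nonneg, inX_bounded, Hx.
Qed.

Lemma inX_lsum {B : Type} (d : nat) (l : list B) (g : B -> vec) :
  (forall b, In b l -> inX d (g b)) -> inX d (fun t => lsum l (fun b => g b t)).
Proof.
  induction l as [|b l IH]; intros H.
  - apply inX_finite with []; [simpl; tauto|reflexivity].
  - apply (inX_add d (g b) (fun t => lsum l (fun b => g b t))).
    + apply H; left; auto.
    + apply IH. intros; apply H; right; auto.
Qed.

Lemma functional_lsum {B : Type} (d : nat) (f : vec -> R) (l : list B) (g : B -> vec) :
  in_dual d f -> (forall b, In b l -> inX d (g b)) ->
  f (fun t => lsum l (fun b => g b t)) = lsum l (fun b => f (g b)).
Proof.
  intros [D [H1 [H2 _]]]. induction l as [|b l IH]; intros H.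
  - assert (H0 : inX d (fun _ => 0)) by (apply inX_finite with []; simpl; tauto || auto).
    specialize (H2 0 _ H0). rewrite Rmult_0_l in H2.
    replace (vscale 0 (fun _ => 0)) with (fun t : list nat => lsum [] (fun b => g b t)) in H2;
      auto.
    apply functional_extensionality. intros t. unfold vscale, lsum. simpl. ring.
  - rewrite lsum_cons, <- IH by (intros; apply H; right; auto).
    rewrite <- H1; [reflexivity| |].
    + apply H; left; auto.
    + apply inX_lsum. intros; apply H; right; auto.
Qed.

(* Failure would give a sequence tending coordinatewise to zero on which [f] is bounded
   away from zero; its averages would then not have small norm. *)
Lemma functional_tail (k : nat) (f : vec -> R) (eps : R) :
  (1 <= k)%nat -> in_dual (S k) f -> 0 < eps ->
  exists L : list (list nat), forall y, inX (S k) y -> (forall t, In t L -> y t = 0) ->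
    Rabs (f y) <= eps * Xnorm (S k) y.
Proof.
  intros hk Hf He. apply NNPP. intros Hn. pose proof Hf as [D HD].
  pose proof (functional_Rabs_le _ _ _ HD) as HDn.
  (* Scaling by the sign of [f y] over the norm of [y] removes the absolute value. *)
  assert (HY : forall n : nat, exists y, inX (S k) y /\
    (forall t, In t (bounded_lists (S k) n) -> y t = 0) /\
    nle (S k) y 1 /\ eps <= f y).
  { intros n. apply NNPP. intros Hn'. apply Hn. exists (bounded_lists (S k) n).
    intros y Hy Hy0. apply Rnot_lt_le. intros Hlt. apply Hn'.
    pose proof (Xnorm_nonneg _ _ (inX_bounded _ _ Hy)) as HN0.
    assert (HN : 0 < Xnorm (S k) y).
    { destruct HN0 as [H|H]; auto. specialize (HDn y Hy). rewrite <- H in *. lra. }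
    set (c := sgn (f y) / Xnorm (S k) y).
    assert (Ec : Rabs c = / Xnorm (S k) y).
    { assert (0 < / Xnorm (S k) y) by (apply Rinv_0_lt_compat; auto).
      unfold c, Rdiv. rewrite Rabs_mult, sgn_Rabs, (Rabs_pos_eq (/ _)) by lra. ring. }
    assert (Ef : c * f y = Rabs (f y) / Xnorm (S k) y).
    { rewrite <- sgn_mult. unfold c, Rdiv. ring. }
    exists (vscale c y). split; [apply inX_scale; auto|]. split; [|split].
    - intros t Ht. unfold vscale. rewrite Hy0 by auto. ring.
    - apply nle_weaken with (Rabs c * Xnorm (S k) y).
      + rewrite Ec, Rinv_l by lra. lra.
      + apply nle_scale, inX_nle; auto.
    - destruct HD as [_ [H2 _]]. rewrite H2, Ef by auto.
      apply Rmult_le_reg_r with (1 := HN). unfold Rdiv.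
      rewrite Rmult_assoc, Rinv_l by lra. lra. }
  apply choice in HY. destruct HY as [Y HY].
  destruct free_ultrafilter_nat as [U [HU HF]].
  (* Chosen so that [f] is below [eps] in absolute value on vectors of norm at most [eta]. *)
  set (eta := eps / (2 * (Rabs D + 1))).
  pose proof (Rabs_pos D) as HD0.
  assert (Heta : 0 < eta) by (apply Rdiv_lt_0_compat; lra).
  (* The sequence is made a [k]-sequence depending on the first entry only. Its limit is zero, so
     equal coefficients [1/m] are allowed. *)
  destruct (small_plegma_averages k U (fun s => Y (hd 0%nat s)) 1 (fun _ => 0) eta HU HF)
    as [m0 Hm0]; auto.
  { intros s. apply HY. }
  { intros t ep Ht Hep. destruct k as [|k']; [lia|]. simpl.
    (* Once [n] exceeds every entry of [t], the vector [Y n] vanishes at [t]. *)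
    destruct (entries_bounded [t]) as [b Hb].
    apply ultra_mono with (3 := HF b); auto. intros n Hn1.
    apply ultra_all; [apply ultra_Uq; auto|]. intros tau.
    destruct (HY n) as [_ [H _]]. rewrite H.
    - rewrite Rminus_0_r, Rabs_R0. lra.
    - apply in_bounded_lists; [apply Ht|]. intros a Ha. apply (In_nth _ _ 0%nat) in Ha.
      destruct Ha as [l [_ <-]]. specialize (Hb t l (or_introl eq_refl)). lia. }
  set (m := S m0). destruct (Hm0 m 0%nat ltac:(unfold m; lia) ltac:(unfold m; lia))
    as [n [_ [_ Hn3]]].
  assert (Hmp : 0 < INR m) by (apply lt_0_INR; unfold m; lia).
  specialize (Hn3 (fun _ => / INR m)).
  set (w := fun i => Y (hd 0%nat (member n k m i))) in *.
  assert (HZ : nle (S k) (fun t => lsum (seq 1 m) (fun i => vscale (/ INR m) (w i) t)) eta).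
  { apply Hn3.
    - intros _. rewrite Rabs_pos_eq; [lra|]. apply Rlt_le, Rinv_0_lt_compat; auto.
    - intros; ring. }
  assert (HwX : forall i, inX (S k) (w i)) by (intros i; apply HY).
  assert (HzX : inX (S k) (fun t => lsum (seq 1 m) (fun i => vscale (/ INR m) (w i) t)))
    by (apply inX_lsum; intros; apply inX_scale; auto).
  specialize (HDn _ HzX). apply Xnorm_le in HZ.
  rewrite (functional_lsum (S k)) in HDn; auto; [|intros; apply inX_scale; auto].
  assert (Hlow : eps <= lsum (seq 1 m) (fun i => f (vscale (/ INR m) (w i)))).
  { apply Rle_trans with (lsum (seq 1 m) (fun _ => / INR m * eps)).
    - rewrite lsum_const, length_seq. right. field. lra.
    - apply lsum_le. intros i _. destruct HD as [_ [H2 _]]. rewrite H2 by auto.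
      apply Rmult_le_compat_l; [apply Rlt_le, Rinv_0_lt_compat; auto|]. apply HY. }
  assert (H1 : eps <= Rabs D * eta).
  { eapply Rle_trans; [apply Hlow|]. eapply Rle_trans; [apply Rle_abs|].
    eapply Rle_trans; [apply HDn|]. apply Rmult_le_compat_l; auto. }
  assert (H3 : eta * (2 * (Rabs D + 1)) = eps) by (unfold eta; field; lra).
  assert (0 <= Rabs D * eta) by (apply Rmult_le_pos; lra).
  lra.
Qed.

(** * Sums in the dual and their images under a bidual functional *)

Lemma bdd_coordinate (d : nat) (s : list nat) :
  subsetN d s -> bdd_lin_functional d (fun y => y s) 1.
Proof.
  intros Hs. repeat split; auto. intros y Hy. rewrite Rmult_1_l.
  apply nle_coord with d; auto. apply inX_nle; auto.
Qed.

Lemma in_dual_scale (d : nat) (c : R) (f : vec -> R) :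
  in_dual d f -> in_dual d (fun x => c * f x).
Proof.
  intros [D HD]. pose proof (functional_Rabs_le _ _ _ HD) as HDn.
  destruct HD as [H1 [H2 _]]. exists (Rabs c * Rabs D). split; [|split].
  - intros x y Hx Hy. rewrite H1 by auto. ring.
  - intros a x Hx. rewrite H2 by auto. ring.
  - intros x Hx. rewrite Rabs_mult, Rmult_assoc. apply Rmult_le_compat_l; auto.
    apply Rabs_pos.
Qed.

Lemma in_dual_add (d : nat) (f g : vec -> R) :
  in_dual d f -> in_dual d g -> in_dual d (fun x => f x + g x).
Proof.
  intros [D [H1 [H2 H3]]] [D' [H1' [H2' H3']]]. exists (D + D'). split; [|split].
  - intros x y Hx Hy. rewrite H1, H1' by auto. ring.
  - intros a x Hx. rewrite H2, H2' by auto. ring.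
  - intros x Hx. eapply Rle_trans; [apply Rabs_triang|].
    specialize (H3 x Hx). specialize (H3' x Hx). lra.
Qed.

Lemma bdd_zero (d : nat) : bdd_lin_functional d (fun _ => 0) 0.
Proof. split; [|split]; intros; rewrite ?Rabs_R0; lra. Qed.

Lemma bidual_lsum {B : Type} (d : nat) (Phi : (vec -> R) -> R) (Cst : R)
    (l : list B) (g : B -> vec -> R) :
  (forall f g, in_dual d f -> in_dual d g -> Phi (fun x => f x + g x) = Phi f + Phi g) ->
  (forall f D, bdd_lin_functional d f D -> Rabs (Phi f) <= Cst * D) ->
  (forall b, In b l -> in_dual d (g b)) ->
  in_dual d (fun y => lsum l (fun b => g b y)) /\
  Phi (fun y => lsum l (fun b => g b y)) = lsum l (fun b => Phi (g b)).
Proof.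
  intros Hadd HC. induction l as [|b l IH]; intros H.
  - split; [exists 0; apply bdd_zero|].
    (* The zero functional is bounded with [D = 0], so [Phi] vanishes on it. *)
    pose proof (HC _ _ (bdd_zero d)) as H0. rewrite Rmult_0_r in H0.
    apply Rabs_le_inv in H0. change (Phi (fun _ => 0) = 0). lra.
  - destruct IH as [IH1 IH2]; [intros; apply H; right; auto|].
    assert (Hb : in_dual d (g b)) by (apply H; left; auto). split.
    + apply (in_dual_add d (g b) _ Hb IH1).
    + rewrite lsum_cons, <- IH2. apply (Hadd (g b) _ Hb IH1).
Qed.

(* Up to the factor [Qval x Ps], a functional of norm one attaining [Qval x Ps] at [x]. *)
Definition norming (x : vec) (Ps : list (list (list nat))) (y : vec) : R :=
  lsum Ps (fun P => fam_l1 x P * lsum P (fun s => sgn (x s) * y s)).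

Lemma norming_bdd (d : nat) (x : vec) (Ps : list (list (list nat))) :
  admissible d Ps -> bdd_lin_functional d (norming x Ps) (Qval x Ps).
Proof.
  intros HP. split; [|split].
  - intros y z _ _. unfold norming. rewrite <- lsum_plus. apply lsum_ext. intros P _.
    rewrite <- Rmult_plus_distr_l, <- lsum_plus. f_equal. apply lsum_ext. intros s _.
    unfold vadd. ring.
  - intros c y _. unfold norming. rewrite <- lsum_scal. apply lsum_ext. intros P _.
    transitivity (fam_l1 x P * (c * lsum P (fun s => sgn (x s) * y s))); [|ring].
    f_equal. rewrite <- lsum_scal. apply lsum_ext. intros s _. unfold vscale. ring.
  - intros y Hy. apply Rle_trans with (lsum Ps (fun P => fam_l1 x P * fam_l1 y P)).
    + eapply Rle_trans; [apply lsum_Rabs|]. apply lsum_le. intros P _.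
      rewrite Rabs_mult, (Rabs_pos_eq (fam_l1 x P)) by apply fam_l1_nonneg.
      apply Rmult_le_compat_l; [apply fam_l1_nonneg|].
      eapply Rle_trans; [apply lsum_Rabs|]. rewrite fam_l1_lsum. right. apply lsum_ext.
      intros s _. rewrite Rabs_mult, sgn_Rabs. ring.
    + eapply Rle_trans; [apply lsum_cauchy_schwarz|].
      apply Rmult_le_compat_l; [apply sqrt_pos|]. apply (inX_nle d y Hy Ps HP).
Qed.

(** The values of [Phi] at the coordinate functionals form a vector [x]. Norming functionals show
    that it has finite norm, hence lies in the space. By [functional_tail] each [f] is a norm limit
    of finite combinations of coordinates, on which [Phi] is evaluation at [x]. *)
Lemma reflexive_X (k : nat) : (1 <= k)%nat -> reflexive (S k).
Proof.
  intros hk Phi Hadd Hscal [Cst HC]. set (d := S k) in *.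
  set (x := fun s => if pb (subsetN d s) then Phi (fun y => y s) else 0).
  assert (Ex : forall s, subsetN d s -> Phi (fun y => y s) = x s).
  { intros s Hs. unfold x. apply pb_true in Hs. rewrite Hs. auto. }
  assert (Hlin : forall (L : list (list nat)) (c : list nat -> R),
    (forall s, In s L -> subsetN d s) ->
    in_dual d (fun y => lsum L (fun s => c s * y s)) /\
    Phi (fun y => lsum L (fun s => c s * y s)) = lsum L (fun s => c s * x s)).
  { intros L c HL.
    destruct (bidual_lsum d Phi Cst L (fun s y => c s * y s) Hadd HC) as [H1 H2].
    - intros s Hs. apply (in_dual_scale d (c s) (fun y => y s)). exists 1.
      apply bdd_coordinate; auto.
    - split; auto. rewrite H2. apply lsum_ext. intros s Hs.
      rewrite (Hscal (c s) (fun y => y s)) by (exists 1; apply bdd_coordinate; auto).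
      rewrite Ex; auto. }
  assert (HB : nle d x (Rabs Cst)).
  { intros Ps HP. pose proof (HC _ _ (norming_bdd d x Ps HP)) as H1.
    (* Together with the bound [Cst * Qval x Ps] for [Phi] this gives [Qval x Ps <= Cst], after
       division if [Qval x Ps] is nonzero. *)
    assert (EP : Phi (norming x Ps) = Qval x Ps ^ 2).
    { unfold norming.
      destruct (bidual_lsum d Phi Cst Ps
        (fun P y => fam_l1 x P * lsum P (fun s => sgn (x s) * y s)) Hadd HC) as [_ ->].
      - intros P HPP. apply in_dual_scale, Hlin. intros s Hs.
        eapply admissible_subsetN; eauto.
      - rewrite Qval_sq. apply lsum_ext. intros P HPP.
        destruct (Hlin P (fun s => sgn (x s))) as [H2 H3].
        + intros s Hs. eapply admissible_subsetN; eauto.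
        + rewrite (Hscal (fam_l1 x P) (fun y => lsum P (fun s => sgn (x s) * y s))), H3
            by auto.
          rewrite (lsum_ext P _ (fun s => Rabs (x s))) by (intros; apply sgn_mult).
          rewrite <- fam_l1_lsum. ring. }
    rewrite EP in H1. pose proof (Qval_nonneg x Ps) as H0.
    destruct H0 as [H0|H0]; [|rewrite <- H0; apply Rabs_pos].
    rewrite Rabs_pos_eq in H1 by apply pow2_ge_0.
    apply Rle_trans with Cst; [|apply Rle_abs].
    apply Rmult_le_reg_r with (1 := H0). lra. }
  assert (Hx : inX d x).
  { apply inX_iff. split; [|eauto]. intros t Ht. unfold x. apply pb_false in Ht.
    rewrite Ht. auto. }
  exists x. split; auto. intros f Hf.
  pose proof (Xnorm_nonneg d x (inX_bounded d x Hx)) as HN.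
  assert (Happrox : forall eps, 0 < eps ->
    Rabs (Phi f - f x) <= eps * (Rabs Cst + Xnorm d x)).
  { intros eps He. destruct (functional_tail k f eps hk Hf He) as [L HL]. fold d in HL.
    set (L' := nodup (list_eq_dec Nat.eq_dec) (filter (fun t => pb (subsetN d t)) L)).
    assert (HL' : forall s, In s L' <-> In s L /\ subsetN d s).
    { intros s. unfold L'. rewrite nodup_In, filter_In, pb_true. tauto. }
    (* The finite part of [f]; what remains is [f] applied to the part of [y] off [L'], where
       [functional_tail] applies. *)
    set (fL := fun y : vec => lsum L' (fun s => f (e s) * y s)).
    destruct (Hlin L' (fun s => f (e s))) as [HfL1 HfL2]; [intros s Hs; apply HL', Hs|].
    fold fL in HfL1, HfL2.
    assert (Hdiff : forall y, inX d y -> Rabs (f y + -1 * fL y) <= eps * Xnorm d y).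
    { intros y Hy. pose proof Hf as [D [H1 [H2 _]]].
      assert (EfL : fL y = f (restr (fun t => In t L') y)).
      { replace (restr (fun t => In t L') y) with
          (fun t => lsum L' (fun s => vscale (y s) (e s) t)).
        - rewrite (functional_lsum d); auto.
          + apply lsum_ext. intros s Hs. rewrite H2; [ring|]. apply inX_e, HL', Hs.
          + intros s Hs. apply inX_scale, inX_e, HL', Hs.
        - apply functional_extensionality. intros t. unfold vscale.
          apply lsum_e, NoDup_nodup. }
      set (y' := restr (fun t => ~ In t L') y).
      assert (Hy' : inX d y') by (apply inX_restr; auto).
      assert (Ey : f y = fL y + f y').
      { rewrite EfL, <- H1 by auto using inX_restr. f_equal.
        apply functional_extensionality. intros t. unfold vadd, y'.
        destruct (classic (In t L')).
        - rewrite restr_in, restr_out by auto. ring.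
        - rewrite restr_out, restr_in by auto. ring. }
      replace (f y + -1 * fL y) with (f y') by (rewrite Ey; ring).
      eapply Rle_trans; [apply HL; auto|].
      - intros t Ht. destruct (classic (subsetN d t)) as [Hs|Hs].
        + apply restr_out. intros H. apply H, HL'. auto.
        + apply inX_supp with d; auto.
      - apply Rmult_le_compat_l; [lra|]. apply Xnorm_le.
        apply nle_mono with y; [intros; apply restr_Rabs_le|]. apply inX_nle; auto. }
    assert (HfN : in_dual d (fun y => -1 * fL y)) by (apply in_dual_scale; auto).
    (* Linearity comes from membership in the dual, but the bound is replaced by [eps], from
       [Hdiff]. *)
    assert (Hg : bdd_lin_functional d (fun y => f y + -1 * fL y) eps).
    { destruct (in_dual_add d f (fun y => -1 * fL y) Hf HfN) as [D [H1 [H2 _]]].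
      split; [|split]; auto. }
    apply HC in Hg. rewrite Hadd, Hscal in Hg by auto.
    assert (HfLx : Phi fL = fL x) by exact HfL2.
    specialize (Hdiff x Hx).
    replace (Phi f - f x) with ((Phi f + -1 * Phi fL) + - (f x + -1 * fL x))
      by (rewrite HfLx; ring).
    eapply Rle_trans; [apply Rabs_triang|]. rewrite Rabs_Ropp.
    assert (Cst * eps <= Rabs Cst * eps)
      by (apply Rmult_le_compat_r; [lra|apply Rle_abs]).
    lra. }
  apply cond_eq. intros eps He. pose proof (Rabs_pos Cst).
  set (K := Rabs Cst + Xnorm d x + 1).
  assert (HK : 0 < K) by (unfold K; lra).
  eapply Rle_lt_trans; [apply (Happrox (eps / 2 / K))|].
  - apply Rdiv_lt_0_compat; lra.
  - assert (E : eps / 2 / K * K = eps / 2) by (field; lra).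
    assert (0 < eps / 2 / K) by (apply Rdiv_lt_0_compat; lra).
    unfold K in E at 2. nra.
Qed.

Theorem mainTheorem19 (k : nat) (hk : (1 <= k)%nat) :
  (* (a) *)
  uncond_basis (S k) /\
  (exists Mseq, infinite_seq Mseq /\ generates (S k) (Xnorm (S k)) e ell1 Mseq) /\
  (* (b) *)
  reflexive (S k) /\
  (* (c) *)
  (forall (x : list nat -> vec) (snorm : (nat -> R) -> R),
     in_SM k (S k) x snorm -> ~ equiv_l1 snorm) /\
  (* (d) *)
  (forall (Mseq : nat -> nat) (x0 : vec),
     infinite_seq Mseq -> inX (S k) x0 -> ~ cesaro_summable (S k) Mseq x0).
Proof.
  split; [apply uncond_basis_X|]. split; [apply generates_ell1|].
  split; [apply reflexive_X; auto|].
  split; [intros x snorm; apply SM_not_l1; auto|]. apply not_cesaro_summable.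
Qed.
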